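(* Let $\mathcal{H}$ be an effective ample second countable Hausdorff groupoid whose unit space $\mathcal{H}^{(0)}$ is a locally compact Cantor space. If $\mathcal{H}$ is groupoid equivalent to $\mathcal{G}_E$ for some countable graph $E$ satisfying Condition (L) and having no sinks and no semi-tails, then there is an injective étale homomorphism $\mathcal{H}\hookrightarrow\mathcal{G}_{E_2}$. Moreover, if $\mathcal{H}^{(0)}$ is compact, then the embedding can be chosen to map $\mathcal{H}^{(0)}$ onto $E_2^\infty$.
   Context: Groupoid equivalence is the standard (Muhly–Renault–Williams) notion of equivalence of topological groupoids. A locally compact Cantor space is a non-empty second countable Hausdorff space with a basis of compact open sets and no isolated points. An étale homomorphism between étale groupoids is a groupoid homomorphism that is a local homeomorphism. Ample: étale with unit space Hausdorff having a basis of compact open sets; effective: the interior of $\{g: s(g)=r(g)\}$ is the unit space. Graph notation: $E=(E^0,E^1,r,s)$; finite paths $e_1\cdots e_n$ with $r(e_i)=s(e_{i+1})$; a sink is a vertex emitting no edges; singular vertices are sinks and vertices emitting infinitely many edges. Condition (L): every cycle (path of positive length with $r=s$) has an exit (an edge $e\ne e_i$ with $s(e)=s(e_i)$ for some edge $e_i$ of the cycle). An infinite path $e_1e_2\cdots$ is wandering if each vertex equals $s(e_i)$ for finitely many $i$; it is a semi-tail if it is wandering and $s(e_i)$ emits only the edge $e_i$ for all $i$. $\partial E=E^\infty\cup\{\mu: r(\mu)\text{ singular}\}$ with basis sets $Z(\mu)\setminus\bigcup_{e\in F}Z(\mu e)$, $Z(\mu)=\{\mu x\in\partial E\}$, $F$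 a finite set of edges from $r(\mu)$; $\sigma_E$ deletes the first edge. $\mathcal{G}_E=\{(x,m-n,y): |x|\ge m,|y|\ge n,\sigma_E^m(x)=\sigma_E^n(y)\}$, $(x,k,y)(y,l,z)=(x,k+l,z)$, $(x,k,y)^{-1}=(y,-k,x)$, unit space $\partial E$, topology generated by $\{(x,m-n,y): x\in U, y\in V,\sigma_E^m(x)=\sigma_E^n(y)\}$ for open $U,V$ on which $\sigma_E^m,\sigma_E^n$ are injective with $\sigma_E^m(U)=\sigma_E^n(V)$. $E_2$ is the graph with one vertex and two loops; $\partial E_2=E_2^\infty$ is the unit space of $\mathcal{G}_{E_2}$. *)

(* Defs.v *)
From HB Require Import structures.
From mathcomp Require Import all_boot all_algebra.
From mathcomp Require Import boolp classical_sets functions cardinality topology.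

Set Implicit Arguments.
Unset Strict Implicit.
Unset Printing Implicit Defensive.

Local Open Scope classical_set_scope.

(* A groupoid (and its unit space) is carried by a subset of an ambient      *)
(* topological type; all topological notions below are for the subspace      *)
(* topology on that subset.                                                  *)
Section Relative.
Context {T : topologicalType}.

Definition ropen (X A : set T) : Prop :=
  A `<=` X /\ exists U : set T, open U /\ A = U `&` X.

Definition rhausdorff (X : set T) : Prop :=
  forall x y, X x -> X y -> x <> y ->
    exists U V : set T, [/\ open U, open V, U x, V y & U `&` V = set0].

Definition rsecond_countable (X : set T) : Prop :=
  exists B : set (set T), [/\ countable B,
    (forall b, B b -> ropen X b) &
    (forall A x, ropen X A -> A x -> exists b, [/\ B b, b x & b `<=` A])].

Definition rlocally_compact (X : set T) : Prop :=
  forall x, X x -> exists U K : set T,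
    [/\ ropen X U, U x, U `<=` K, K `<=` X & compact K].

Definition compact_open_basis (X : set T) : Prop :=
  forall A x, ropen X A -> A x ->
    exists K : set T, [/\ ropen X K, compact K, K x & K `<=` A].

Definition rinterior (X A : set T) : set T :=
  [set x | exists U, [/\ ropen X U, U x & U `<=` A]].

Definition lc_cantor (X : set T) : Prop :=
  [/\ X !=set0, rsecond_countable X, rhausdorff X, compact_open_basis X &
      forall x, X x -> ~ ropen X [set x]].

End Relative.

Definition local_homeo {T1 T2 : topologicalType} (X : set T1) (Y : set T2)
  (f : T1 -> T2) : Prop :=
  [/\ (forall x, X x -> Y (f x)),
      {within X, continuous f} &
      forall x, X x -> exists U : set T1,
        [/\ ropen X U, U x,
            (forall a b, U a -> U b -> f a = f b -> a = b) &
            (forall W, ropen X W -> W `<=` U -> ropen Y (f @` W))]].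

Record tgroupoid (T : topologicalType) := TGroupoid {
  gcar : set T;
  gr : T -> T;
  gs : T -> T;
  ginv : T -> T;
  gmul : T -> T -> T       (* composition, meaningful when gs g = gr h *)
}.

Section Groupoids.
Context {T : topologicalType} (G : tgroupoid T).
Local Notation C := (gcar G).
Local Notation r := (gr G).
Local Notation s := (gs G).
Local Notation inv := (ginv G).
Local Notation mul := (gmul G).

Definition units : set T := [set x | C x /\ r x = x].

Definition composable : set (T * T) :=
  [set p | [/\ C p.1, C p.2 & s p.1 = r p.2]].

Definition is_groupoid : Prop :=
  [/\ (forall g, C g -> [/\ C (r g), C (s g) & C (inv g)] /\
          [/\ r (r g) = r g, s (r g) = r g, r (s g) = s g & s (s g) = s g]),
      (forall g h, composable (g, h) ->
          [/\ C (mul g h), r (mul g h) = r g & s (mul g h) = s h]),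
      (forall g h k, composable (g, h) -> composable (h, k) ->
          mul (mul g h) k = mul g (mul h k)),
      (forall g, C g -> mul (r g) g = g /\ mul g (s g) = g) &
      (forall g, C g -> [/\ r (inv g) = s g, s (inv g) = r g,
          mul g (inv g) = r g & mul (inv g) g = s g])].

Definition topological_groupoid : Prop :=
  [/\ is_groupoid,
      {within composable, continuous (fun p : T * T => mul p.1 p.2)} &
      {within C, continuous inv}].

Definition etale : Prop :=
  topological_groupoid /\ local_homeo C units r.

Definition ample : Prop :=
  [/\ etale, rhausdorff units & compact_open_basis units].

Definition effective : Prop :=
  rinterior C [set g | C g /\ s g = r g] = units.

End Groupoids.

Definition ghom {T1 T2 : topologicalType} (G : tgroupoid T1) (H : tgroupoid T2)
  (f : T1 -> T2) : Prop :=
  (forall g, gcar G g -> gcar H (f g)) /\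
  (forall g h, composable G (g, h) ->
     gs H (f g) = gr H (f h) /\ f (gmul G g h) = gmul H (f g) (f h)).

Definition etale_embedding {T1 T2 : topologicalType} (G : tgroupoid T1)
  (H : tgroupoid T2) (f : T1 -> T2) : Prop :=
  [/\ ghom G H f, local_homeo (gcar G) (gcar H) f &
      forall g h, gcar G g -> gcar G h -> f g = f h -> g = h].

(* Groupoid equivalence (Muhly--Renault--Williams)                            *)
Definition groupoid_equivalent {TG TH : topologicalType}
  (G : tgroupoid TG) (H : tgroupoid TH) : Prop :=
  exists (TZ : topologicalType) (Z : set TZ) (rho : TZ -> TG) (sig : TZ -> TH)
         (la : TG -> TZ -> TZ) (ra : TZ -> TH -> TZ),
  let LD := [set p : TG * TZ | [/\ gcar G p.1, Z p.2 & gs G p.1 = rho p.2]] in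
  let RD := [set p : TZ * TH | [/\ Z p.1, gcar H p.2 & sig p.1 = gr H p.2]] in
  (rlocally_compact Z /\ rhausdorff Z) /\
  [/\
   [/\ (forall z, Z z -> units G (rho z)), {within Z, continuous rho},
       (forall z, Z z -> units H (sig z)) & {within Z, continuous sig}],
   [/\ (forall p, LD p -> Z (la p.1 p.2) /\ rho (la p.1 p.2) = gr G p.1),
       (forall g g' z, composable G (g, g') -> LD (g', z) ->
          la (gmul G g g') z = la g (la g' z)),
       (forall z, Z z -> la (rho z) z = z) &
       {within LD, continuous (fun p : TG * TZ => la p.1 p.2)}] /\
      ((forall p, LD p -> la p.1 p.2 = p.2 -> p.1 = rho p.2) /\
       (forall K : set (TZ * TZ), K `<=` Z `*` Z -> compact K ->
          compact [set p | LD p /\ K (la p.1 p.2, p.2)])),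
   [/\ (forall p, RD p -> Z (ra p.1 p.2) /\ sig (ra p.1 p.2) = gs H p.2),
       (forall z h h', composable H (h, h') -> RD (z, h) ->
          ra z (gmul H h h') = ra (ra z h) h'),
       (forall z, Z z -> ra z (sig z) = z) &
       {within RD, continuous (fun p : TZ * TH => ra p.1 p.2)}] /\
      ((forall p, RD p -> ra p.1 p.2 = p.1 -> p.2 = sig p.1) /\
       (forall K : set (TZ * TZ), K `<=` Z `*` Z -> compact K ->
          compact [set p | RD p /\ K (p.1, ra p.1 p.2)])),
   (forall g z h, LD (g, z) -> RD (z, h) ->
      [/\ rho (ra z h) = rho z, sig (la g z) = sig z &
          la g (ra z h) = ra (la g z) h]) &
   (* rho induces a homeomorphism Z/H ~ G^(0), sig one G\Z ~ H^(0) *)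
   [/\ (forall W, ropen Z W -> ropen (units G) (rho @` W)),
       rho @` Z = units G &
       (forall z1 z2, Z z1 -> Z z2 ->
          rho z1 = rho z2 -> exists h, RD (z2, h) /\ z1 = ra z2 h)] /\
   [/\ (forall W, ropen Z W -> ropen (units H) (sig @` W)),
       sig @` Z = units H &
       (forall z1 z2, Z z1 -> Z z2 ->
          sig z1 = sig z2 -> exists g, LD (g, z2) /\ z1 = la g z2)]].

(* PFin v p : finite path with source vertex v and edge list p (p = [::]   *)
(*            is the vertex v; for p non-empty, v = es (head p));          *)
(* PInf f   : infinite path f 0, f 1, ...                                   *)
Inductive gpath (V Ed : Type) :=
  | PFin of V & seq Ed
  | PInf of (nat -> Ed).
Arguments PFin {V Ed}.
Arguments PInf {V Ed}.

Section Graph.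
Context {V Ed : countType} (er es : Ed -> V).

Definition fpath (v : V) (p : seq Ed) : Prop :=
  match p with
  | [::] => True
  | e :: _ => es e = v /\ path (fun a b => er a == es b) e (behead p)
  end.

Definition ipath (f : nat -> Ed) : Prop := forall i, er (f i) = es (f i.+1).

Definition pend (v : V) (p : seq Ed) : V := last v [seq er e | e <- p].

Definition sink (v : V) : Prop := forall e, es e <> v.
Definition singular (v : V) : Prop := sink v \/ ~ finite_set [set e | es e = v].

Definition bpaths : set (gpath V Ed) :=
  [set x | match x with
           | PFin v p => fpath v p /\ singular (pend v p)
           | PInf f => ipath f
           end].

Definition psrc (x : gpath V Ed) : V :=
  match x with PFin v _ => v | PInf f => es (f 0) end.

Definition pedge (x : gpath V Ed) (i : nat) : option Ed :=
  match x with PFin _ p => onth p i | PInf f => Some (f i) end.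

Definition len_ge (x : gpath V Ed) (m : nat) : Prop :=
  match x with PFin _ p => m <= size p | PInf _ => True end.

(* sigma_E^m (meaningful when |x| >= m) *)
Definition shift (m : nat) (x : gpath V Ed) : gpath V Ed :=
  match x with
  | PFin v p => PFin (last v [seq er e | e <- take m p]) (drop m p)
  | PInf f => PInf (fun i => f (i + m))
  end.

Definition cyl (v : V) (p : seq Ed) : set (gpath V Ed) :=
  [set x | [/\ bpaths x, psrc x = v &
              forall i, i < size p -> pedge x i = onth p i]].

Definition bpath_base : set (set (gpath V Ed)) :=
  [set B | exists (v : V) (p : seq Ed) (F : seq Ed),
     [/\ fpath v p, (forall e, e \in F -> es e = pend v p) &
         B = [set x | cyl v p x /\ forall e, e \in F -> ~ cyl v (rcons p e) x]]].

Definition condL : Prop :=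
  forall (v : V) (p : seq Ed), fpath v p -> p <> [::] -> pend v p = v ->
    exists2 ei, ei \in p & exists e, es e = es ei /\ e <> ei.

Definition no_sinks : Prop := forall v, ~ sink v.

Definition wandering (f : nat -> Ed) : Prop :=
  forall v, finite_set [set i | es (f i) = v].

Definition semi_tail (f : nat -> Ed) : Prop :=
  ipath f /\ wandering f /\ forall i e, es e = es (f i) -> e = f i.

Definition no_semi_tails : Prop := forall f, ~ semi_tail f.

End Graph.

Definition bspace {V Ed : countType} (er es : Ed -> V) := gpath V Ed.
HB.instance Definition _ {V Ed : countType} (er es : Ed -> V) :=
  gen_eqMixin (bspace er es).
HB.instance Definition _ {V Ed : countType} (er es : Ed -> V) :=
  gen_choiceMixin (bspace er es).
HB.instance Definition _ {V Ed : countType} (er es : Ed -> V) :=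
  isSubBaseTopological.Build (bspace er es)
    (@bpath_base V Ed er es) id.

Definition GEtype {V Ed : countType} (er es : Ed -> V) :=
  (bspace er es * int * bspace er es)%type.

Section GraphGroupoid.
Context {V Ed : countType} (er es : Ed -> V).
Local Open Scope ring_scope.

Definition GEcar : set (GEtype er es) :=
  [set g | exists (x y : bspace er es) (m n : nat),
     [/\ bpaths er es x, bpaths er es y, len_ge x m & len_ge y n] /\
     (shift er m x = shift er n y /\ g = (x, m%:Z - n%:Z, y))].

Definition GEbase : set (set (GEtype er es)) :=
  [set W | exists (m n : nat) (U U' : set (bspace er es)),
     [/\ open U, open U', U `<=` bpaths er es & U' `<=` bpaths er es] /\
     ((forall x, U x -> len_ge x m) /\ (forall y, U' y -> len_ge y n)) /\
     [/\ (forall a b, U a -> U b -> shift er m a = shift er m b -> a = b),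
         (forall a b, U' a -> U' b -> shift er n a = shift er n b -> a = b),
         shift er m @` U = shift er n @` U' &
         W = [set g | exists x y, [/\ U x, U' y, shift er m x = shift er n y &
                                      g = (x, m%:Z - n%:Z, y)]]]].

Definition GE_r (g : GEtype er es) : GEtype er es := (g.1.1, 0, g.1.1).
Definition GE_s (g : GEtype er es) : GEtype er es := (g.2, 0, g.2).
Definition GE_inv (g : GEtype er es) : GEtype er es := (g.2, - g.1.2, g.1.1).
Definition GE_mul (g h : GEtype er es) : GEtype er es :=
  (g.1.1, g.1.2 + h.1.2, h.2).

End GraphGroupoid.
Arguments GEcar {V Ed} er es.
Arguments GEbase {V Ed} er es.

HB.instance Definition _ {V Ed : countType} (er es : Ed -> V) :=
  gen_eqMixin (GEtype er es).
HB.instance Definition _ {V Ed : countType} (er es : Ed -> V) :=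
  gen_choiceMixin (GEtype er es).
HB.instance Definition _ {V Ed : countType} (er es : Ed -> V) :=
  isSubBaseTopological.Build (GEtype er es) (GEbase er es) id.

Definition graph_groupoid {V Ed : countType} (er es : Ed -> V)
  : tgroupoid (GEtype er es) :=
  TGroupoid (GEcar er es) (@GE_r _ _ er es) (@GE_s _ _ er es)
            (@GE_inv _ _ er es) (@GE_mul _ _ er es).

Definition E2r : bool -> unit := fun _ => tt.
Definition E2s : bool -> unit := fun _ => tt.
Definition G_E2 := graph_groupoid E2r E2s.

(* Main.v *)
Require Import Defs.
From HB Require Import structures.
From mathcomp Require Import all_boot all_algebra.
From mathcomp Require Import boolp classical_sets functions cardinality topology.
From mathcomp Require finmap.
From mathcomp Require Import zify.
Local Open Scope classical_set_scope.

(* Enumerate the edges out of each vertex and code the k-th one (k = 0, 1, ...)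
   by the word 0^k 1, except that the last edge out of a finite emitter is coded
   by 0^k.  As E has no sinks, the codes at a vertex v cover every binary
   sequence, up to 0^oo at an infinite emitter, which codes the finite path
   stopping there.  Concatenating codes therefore gives a homeomorphism from
   the boundary paths starting at v onto {0,1}^oo: the words do get infinitely
   long, because only the unique edge out of a vertex has the empty code, and
   Condition (L) and the absence of semi-tails exclude infinite paths that
   eventually use only such edges.  Prefix exchanges mu x |-> nu x become prefix
   exchanges of binary sequences, with lag |code mu| - |code nu|; by (L) a
   nontrivial isotropy element keeps a nonzero lag.

   Let Z be an equivalence from H to G_E, with anchors rho and sig.  Both are
   local homeomorphisms, since the actions are free and proper and the groupoids
   are etale.  As H^(0) is zero-dimensional, rho has a global continuous section
   sec, and h . sec(s h) = sec(r h) . gamma(h) defines a faithful homomorphism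
   gamma : H -> G_E.  Composing with the coding, H acts on H^(0) by prefix
   exchanges through a local homeomorphism f : H^(0) -> {0,1}^oo.  Partitioning
   H^(0) into sets on which f is injective, and prefixing f on the n-th piece by
   0^n 1, makes f injective.  If H^(0) is compact, the image of f is a finite
   union of cylinders of the same length; replacing their n prefixes by the
   complete prefix code 1, 01, ..., 0^(n-2) 1, 0^(n-1) makes f bijective. *)

Set Implicit Arguments.
Unset Strict Implicit.
Unset Printing Implicit Defensive.
Import GRing.Theory.
Local Arguments Defs.fpath : simpl never.


(** * Prefixes, shifts and concatenation of paths *)

Section Paths.
Variables (V Ed : countType) (er es : Ed -> V).
Implicit Types (v : V) (p q : seq Ed) (x y : gpath V Ed).
Local Notation bpath := (bpaths er es).
Local Notation sh := (shift er).
Local Notation src := (psrc es).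

Lemma fpath_cons v e p : Defs.fpath er es v (e :: p) <-> es e = v /\ Defs.fpath er es (er e) p.
Proof.
rewrite /Defs.fpath; split; last first.
  by case: p => [|a p] /= [-> //] [<- ->]; rewrite eqxx.
by case: p => [|a p] /= [-> //] /andP[/eqP-> ->].
Qed.

Lemma fpath_cat v p q :
  Defs.fpath er es v (p ++ q) <-> Defs.fpath er es v p /\ Defs.fpath er es (pend er v p) q.
Proof.
elim: p v => [|e p IH] v; first by split=> // -[].
rewrite cat_cons !fpath_cons IH /pend /=; tauto.
Qed.

Definition pfx x k : seq Ed :=
  match x with PFin _ p => take k p | PInf f => mkseq f k end.

Lemma size_pfx x k : len_ge x k -> size (pfx x k) = k.
Proof. by case: x => [v p|f] /=; rewrite ?size_mkseq // => /size_takel. Qed.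

Lemma pfxD x m k : pfx x (m + k) = pfx x m ++ pfx (sh m x) k.
Proof.
case: x => [v p|f] /=; first by rewrite takeD.
rewrite /mkseq iotaD map_cat; congr (_ ++ _).
by rewrite add0n -[X in iota X]addn0 iotaDl -map_comp; apply: eq_map => i /=; rewrite addnC.
Qed.

Lemma onth_pfx x k i : i < k -> onth (pfx x k) i = pedge x i.
Proof.
case: x => [v p|f] /= ik.
  rewrite -{2}(cat_take_drop k p) onth_cat size_take_min.
  case: ltnP => // h; rewrite !onth_default ?size_drop ?size_take_min //.
  by move: h; lia.
by rewrite /mkseq onth_map onthE (nth_map 0) ?size_iota //= nth_iota.
Qed.

Lemma shift0 x : sh 0 x = x.
Proof.
case: x => [v p|f] /=; first by rewrite take0 drop0.
by congr PInf; apply/funext => i; rewrite addn0.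
Qed.

Lemma shiftD m n x : sh m (sh n x) = sh (n + m) x.
Proof.
case: x => [v p|f] /=; last by congr PInf; apply/funext => i; rewrite -addnA (addnC m).
by rewrite takeD map_cat last_cat drop_drop addnC.
Qed.

Lemma pedge_shift m x i : pedge (sh m x) i = pedge x (i + m).
Proof.
case: x => [v p|f] //=.
rewrite -{2}(cat_take_drop m p) onth_cat size_take_min; case: ltnP => h; first by (exfalso; lia).
case: (leqP m (size p)) => hm; first by (congr onth; lia).
by rewrite !onth_default ?size_drop //; lia.
Qed.

Lemma len_ge_shift m k x : len_ge x (m + k) -> len_ge (sh m x) k.
Proof. by case: x => //= v p; rewrite size_drop; lia. Qed.

Lemma len_ge_shiftV m k x : len_ge x m -> len_ge (sh m x) k -> len_ge x (m + k).
Proof. by case: x => //= v p; rewrite size_drop; lia. Qed.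

Lemma len_geW m k x : m <= k -> len_ge x k -> len_ge x m.
Proof. by case: x => //= v p; lia. Qed.

Lemma len_geS x m : len_ge x m.+1 <-> pedge x m <> None.
Proof.
case: x => [v p|f] //=; have := onthTE p m.
by case: onth => //= [a|] <-; split.
Qed.

Lemma gpath_ext x y : src x = src y -> (forall i, pedge x i = pedge y i) -> x = y.
Proof.
case: x y => [v p|f] [w q|g] /=.
- by move=> -> h; congr PFin; apply: eq_from_onth.
- by move=> _ /(_ (size p)); rewrite onth_default.
- by move=> _ /(_ (size q)); rewrite onth_default.
- by move=> _ h; congr PInf; apply/funext => i; case: (h i).
Qed.

Lemma bpaths_shift x m : bpath x -> len_ge x m -> bpath (sh m x).
Proof.
case: x => [v p|f] /=; last by move=> h _ i; rewrite addSn.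
move=> [+ +] _; rewrite -{1}(cat_take_drop m p) fpath_cat => -[_ h1] h2; split=> //.
by rewrite /pend -last_cat -map_cat cat_take_drop.
Qed.

Lemma pedge_src x i e : bpath x -> pedge x i = Some e ->
  src (sh i x) = es e /\ src (sh i.+1 x) = er e.
Proof.
move=> bx xi.
have h y e0 : bpath y -> pedge y 0 = Some e0 -> src y = es e0 /\ src (sh 1 y) = er e0.
  case: y => [v [|a p]|f] //=.
    by rewrite fpath_cons take0 => -[[<- _] _] [<-].
  by move=> h [<-]; rewrite add0n -h.
have hl : len_ge x i by apply: (@len_geW _ i.+1) => //; apply/len_geS; rewrite xi.
by have := h (sh i x) e (bpaths_shift bx hl); rewrite pedge_shift shiftD addn1; apply.
Qed.

Lemma pend_pfx x m : bpath x -> len_ge x m -> Defs.fpath er es (src x) (pfx x m) /\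
  pend er (src x) (pfx x m) = src (sh m x).
Proof.
elim: m => [|m IH] bx lx.
  by rewrite shift0; case: x bx lx => [v p|f] //=; rewrite take0.
have lm : len_ge x m by exact: len_geW lx.
have [h1 h2] := IH bx lm.
move/len_geS : (lx); case E: (pedge x m) => [e|] // _.
have [s1 s2] := pedge_src bx E.
rewrite -addn1 pfxD; have -> : pfx (sh m x) 1 = [:: e].
  apply: eq_from_onth_le => i; rewrite size_pfx; last by apply: len_ge_shift; rewrite addn1.
  move=> /= i1; have -> : i = 0 by move: i1; lia.
  by rewrite onth_pfx // pedge_shift.
split; first by rewrite fpath_cat fpath_cons h2 s1.
by rewrite /pend map_cat last_cat /= addn1 s2.
Qed.

(** Concatenation of [p] and [t]. For an infinite [t] the default value of [nth] supplies the edges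
    after [p]. *)
Definition prep v p (t : gpath V Ed) : gpath V Ed :=
  match t with
  | PFin _ q => PFin v (p ++ q)
  | PInf f => PInf (fun i => nth (f (i - size p)) p i)
  end.

Lemma pedge_prep v p t i :
  pedge (prep v p t) i = if i < size p then onth p i else pedge t (i - size p).
Proof.
case: t => [w q|f] /=; first by rewrite onth_cat.
case: ltnP => h; last by rewrite nth_default.
by rewrite onthE (nth_map (f (i - size p))).
Qed.

Lemma len_ge_prep v p t : len_ge (prep v p t) (size p).
Proof. by case: t => //= w q; rewrite size_cat leq_addr. Qed.

Lemma pfx_prep v p t : pfx (prep v p t) (size p) = p.
Proof.
apply: eq_from_onth_le => i; rewrite size_pfx ?maxnn; last exact: len_ge_prep.
move=> h.
by rewrite onth_pfx // pedge_prep h.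
Qed.

Lemma src_prep v p t : Defs.fpath er es v p -> src t = pend er v p -> src (prep v p t) = v.
Proof.
case: t => //= f; case: p => [|e p] //=.
by rewrite fpath_cons => -[].
Qed.

Lemma bpaths_prep v p t : Defs.fpath er es v p -> bpath t -> src t = pend er v p ->
  bpath (prep v p t).
Proof.
move=> fp; case: t => [w q|f] /=.
  move=> [h1 h2] E; rewrite fpath_cat -E; split=> //.
  by rewrite /pend map_cat last_cat -/(pend er v p) -E.
move=> fpf; elim: p v fp => [|e p IH] v; first by move=> _ _ i /=; rewrite !nth_nil !subn0.
rewrite fpath_cons => -[_ fp] E; have hp := IH _ fp E.
move=> [|i] /=; last by exact: hp.
case: p fp E {IH hp} => [|a p] /=; last by case=> ->.
by rewrite /pend /= => _ ->.
Qed.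

Lemma shift_prep v p t : src t = pend er v p -> sh (size p) (prep v p t) = t.
Proof.
case: t => [w q|f] /= E.
  by rewrite take_size_cat // drop_size_cat //; congr PFin; rewrite E.
congr PInf; apply/funext => i.
by rewrite nth_default ?addnK // leq_addl.
Qed.

End Paths.

(** * Binary words of the form 0^k 1 and 0^k *)

Section Codes.

Definition starts (s : seq bool) (b : nat -> bool) :=
  forall i, i < size s -> b i = nth false s i.

Definition capp (s : seq bool) (b : nat -> bool) : nat -> bool :=
  fun i => if i < size s then nth false s i else b (i - size s).

Definition code k (l : bool) : seq bool :=
  nseq k false ++ (if l then [::] else [:: true]).

Lemma size_code k l : size (code k l) = k + ~~ l.
Proof. by rewrite /code size_cat size_nseq; case: l. Qed.

Lemma nth_code k l i : nth false (code k l) i = ~~ l && (i == k).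
Proof.
rewrite /code nth_cat size_nseq nth_nseq; case: ltnP => h.
  by rewrite ltn_eqF // andbF.
case: l => /=; first by rewrite nth_nil.
case: (ltngtP i k) h => // [ki _|-> _]; last by rewrite subnn.
by rewrite nth_default //= subn_gt0.
Qed.

(** A final 1 in the shorter word would face a 0 of the longer one. This separates the edges out of
    one vertex, and later the pieces of the unit space. *)
Lemma code_clash k l k' l' b :
  starts (code k l) b -> starts (code k' l') b -> k < k' -> l.
Proof.
move=> h h' kk; apply/negPn/negP => nl.
have := h k; rewrite size_code nl addn1 ltnSn nth_code nl eqxx => /(_ isT).
rewrite h' ?size_code ?ltn_addr // nth_code => /andP[_ /eqP E].
by rewrite E ltnn in kk.
Qed.

Lemma starts_capp s b : starts s (capp s b).
Proof. by move=> i h; rewrite /capp h. Qed.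

Lemma starts_cappE s b : starts s b -> capp s (fun n => b (n + size s)) = b.
Proof.
move=> h; apply/funext => i; rewrite /capp; case: ltnP => [/h //|k].
by rewrite subnK.
Qed.

Lemma capp_shift s b i : capp s b (i + size s) = b i.
Proof. by rewrite /capp ltnNge leq_addl /= addnK. Qed.

End Codes.

(** * Coding boundary paths by binary sequences *)

Section Coding.
Variables (V Ed : countType) (er es : Ed -> V).
Implicit Types (v : V) (p q : seq Ed) (x y : gpath V Ed).
Local Notation bpath := (bpaths er es).
Local Notation sh := (shift er).
Local Notation src := (psrc es).

Definition out_idx v : pred nat := fun i => `[< exists e, es e = v /\ pickle e = i >].
(** Counting closes the gaps that [pickle] leaves between the edges out of one vertex, so that ranks
    run through 0, 1, 2 and so on. *)
Definition rk e := count (out_idx (es e)) (iota 0 (pickle e)).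
Definition is_last e := `[< forall e', es e' = es e -> pickle e' <= pickle e >].
Definition ecode e := code (rk e) (is_last e).
Definition ecodes p := flatten (map ecode p).
Definition word x k := ecodes (pfx x k).
(* When [x] is finite, the positions beyond its code are filled with 0. *)
Definition coding x : nat -> bool := fun n => `[< exists k, nth false (word x k) n >].

Lemma rk_lt e e' : es e = es e' -> pickle e < pickle e' -> rk e < rk e'.
Proof.
move=> E h; have [d Ed'] : exists d, pickle e' = pickle e + d.+1.
  by exists (pickle e' - (pickle e).+1); lia.
rewrite /rk E Ed' iotaD count_cat -[X in X < _]addn0 ltn_add2l -has_count; apply/hasP.
exists (pickle e); first by rewrite mem_iota add0n leqnn -Ed'.
by apply/asboolP; exists e.
Qed.

Lemma rk_inj e e' : es e = es e' -> rk e = rk e' -> e = e'.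
Proof.
move=> E Er; apply: (pcan_inj (@pickleK Ed)).
have h := @rk_lt e e' E; have h' := @rk_lt e' e (esym E).
by case: (ltngtP (pickle e) (pickle e')) => // /[dup] ? => [/h|/h']; rewrite Er ltnn.
Qed.

Lemma is_last_rk e e' : is_last e -> es e' = es e -> rk e' <= rk e.
Proof.
move=> /asboolP h E; have := h _ E; rewrite leq_eqVlt => /orP[/eqP|/rk_lt-/(_ E)/ltnW //].
by move=> /(pcan_inj (@pickleK Ed)) ->.
Qed.

(** Take the least index at least [i] that belongs to an edge out of [v]; no such edge is passed
    over, so the count does not change in between. *)
Lemma next_out v i : (exists e, es e = v /\ i <= pickle e) ->
  exists e, [/\ es e = v, i <= pickle e & rk e = count (out_idx v) (iota 0 i)].
Proof.
move=> [e0 [E0 i0]].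
have ex : exists j, (i <= j) && out_idx v j.
  by exists (pickle e0); rewrite i0; apply/asboolP; exists e0.
have [j + jmin] := ex_minnP ex; move=> /andP[ij /asboolP[e [E Ej]]]; exists e; split=> //.
  by rewrite Ej.
rewrite /rk Ej -(subnK ij) [X in iota 0 X]addnC iotaD count_cat E.
rewrite -[RHS]addn0; congr addn; apply/eqP; rewrite -leqn0 leqNgt -has_count.
apply/hasP => -[k]; rewrite mem_iota add0n => /andP[ik kj] ok.
by have := jmin k; rewrite ik ok => /(_ isT); lia.
Qed.

Hypothesis nosink : no_sinks es.

(** Ranks have no gaps: from an edge that is not last, [next_out] leads to the following rank. The
    absence of sinks provides rank 0. *)
Lemma rank_or_last v k : (exists e, es e = v /\ rk e = k) \/
  (exists e, [/\ es e = v, is_last e & rk e < k]).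
Proof.
elim: k => [|k [[e [E Er]]|[e [E le Er]]]].
- left; have /existsNP[e0 /contrapT E0] : ~ forall e, es e <> v by exact: nosink.
  by have [|e [E _ Er]] := @next_out v 0; [exists e0 | exists e].
- case: (boolP (is_last e)) => [h|/asboolPn].
    by right; exists e; rewrite Er ltnSn.
  move=> /existsNP[e' /not_implyP[E' /negP]]; rewrite -ltnNge => h.
  have [|e2 [E2 _ Er2]] := @next_out v (pickle e).+1; first by exists e'; rewrite E'.
  left; exists e2; split=> //; rewrite Er2 -Er -[(pickle e).+1]addn1 iotaD count_cat /=.
  have -> : out_idx v (0 + pickle e) by apply/asboolP; exists e.
  by rewrite /rk E addn0 addn1.
- by right; exists e; split=> //; rewrite ltnS ltnW.
Qed.

Lemma is_last_finite e : is_last e -> finite_set [set e' | es e' = es e].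
Proof.
move=> /asboolP h.
apply: (@sub_finite_set _ _ [set` pmap unpickle (iota 0 (pickle e).+1)]); last first.
  exact: finite_seq.
move=> e' /h he; suff : e' \in pmap unpickle (iota 0 (pickle e).+1) by [].
rewrite mem_pmap; apply/mapP; exists (pickle e'); last by rewrite pickleK.
by rewrite mem_iota add0n ltnS.
Qed.

(** Without a last edge the indices of the edges out of [v] are unbounded. *)
Lemma no_last_infinite v : (forall e, es e = v -> ~ is_last e) ->
  ~ finite_set [set e | es e = v].
Proof.
move=> h /finite_seqP[s hs].
have key k : exists e, es e = v /\ k <= pickle e.
  elim: k => [|k [e [E ke]]].
    have /existsNP[e0 /contrapT E0] : ~ forall e, es e <> v by exact: nosink.
    by exists e0.
  have /negP/asboolPn/existsNP[e' /not_implyP[E' /negP]] := h e E.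
  by rewrite -ltnNge => h'; exists e'; rewrite E'; split=> //; apply: leq_ltn_trans h'.
have [e [E]] := key (\max_(e <- s) pickle e).+1.
have : [set e | es e = v] e by [].
by rewrite hs /= => es' /leq_trans/(_ (leq_bigmax_seq _ es' isT)); rewrite ltnn.
Qed.

Lemma ecodes_cat p q : ecodes (p ++ q) = ecodes p ++ ecodes q.
Proof. by rewrite /ecodes map_cat flatten_cat. Qed.

Lemma wordD x m k : word x (m + k) = word x m ++ word (sh m x) k.
Proof. by rewrite /word (pfxD er) ecodes_cat. Qed.

(** Words of longer prefixes extend those of shorter ones, so any word that reaches position [n]
    already decides the existential in [coding]. *)
Lemma coding_starts x k : starts (word x k) (coding x).
Proof.
move=> n h; apply/asboolP/idP => [[k']|]; last by exists k.
case: (leqP k k') => kk; first by rewrite -(subnKC kk) wordD nth_cat h.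
rewrite -(subnKC (ltnW kk)) wordD nth_cat; case: ltnP => // h'.
by rewrite nth_default.
Qed.

Lemma coding_shift x m n : coding x (n + size (word x m)) = coding (sh m x) n.
Proof.
have E k : nth false (word x (m + k)) (n + size (word x m)) = nth false (word (sh m x) k) n.
  by rewrite wordD nth_cat ltnNge leq_addl /= addnK.
apply/asboolP/asboolP => -[k h]; last by exists (m + k); rewrite E.
case: (leqP m k) h => mk; first by rewrite -(subnKC mk) E => h; exists (k - m).
by rewrite nth_default // -(subnKC (ltnW mk)) wordD size_cat; lia.
Qed.

Lemma coding_capp x m : coding x = capp (word x m) (coding (sh m x)).
Proof.
apply/funext => n; rewrite /capp; case: ltnP => h; first by rewrite (coding_starts h).
by rewrite -coding_shift subnK.
Qed.

Lemma word_prep v p t : word (prep v p t) (size p) = ecodes p.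
Proof. by rewrite /word pfx_prep. Qed.

Lemma coding_prep v p t : src t = pend er v p -> coding (prep v p t) = capp (ecodes p) (coding t).
Proof. by move=> E; rewrite (coding_capp _ (size p)) word_prep (shift_prep E). Qed.

Lemma word1 x e : pedge x 0 = Some e -> word x 1 = ecode e.
Proof. by case: x => [v [|a p]|f] //= [<-]; rewrite /word /ecodes /= ?take0 /= cats0. Qed.

Lemma coding_head x e : pedge x 0 = Some e -> starts (ecode e) (coding x).
Proof. by move=> /word1 <-; exact: coding_starts. Qed.

Lemma coding_nil v : coding (PFin v [::]) = fun=> false.
Proof. by apply/funext => n; apply/asboolP => -[k]; rewrite /word /= /ecodes /= nth_nil. Qed.

Lemma pedge_None x : pedge x 0 = None -> x = PFin (src x) [::].
Proof. by case: x => [v [|a p]|f]. Qed.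

Lemma singular_not_last v e : singular es v -> es e = v -> ~ is_last e.
Proof. by move=> [h E _|h E /is_last_finite]; [exact: (h e E)|rewrite E]. Qed.

(** If the first edges had different ranks, [code_clash] would make the one of smaller rank last,
    hence of maximal rank. If only [y] is empty, its source is singular, so the first edge of [x] is
    not last and its code contains a 1, whereas [y] is coded by zeros. *)
Lemma coding_inj0 x y : bpath x -> bpath y -> src x = src y -> coding x = coding y ->
  pedge x 0 = pedge y 0.
Proof.
wlog: x y / pedge x 0 <> None.
  move=> wl bx byy E Ep; case X: (pedge x 0) => [e|]; first by rewrite -X; apply: wl; rewrite ?X.
  case Y: (pedge y 0) => [e|] //; rewrite -X -Y; symmetry; apply: wl => //.
  by rewrite Y.
case X: (pedge x 0) => [e|] // _ bx byy E Ep.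
have Ee : src x = es e by have := pedge_src bx X; rewrite shift0 => -[].
have hx := coding_head X.
case Y: (pedge y 0) => [e'|].
  have Ee' : src y = es e' by have := pedge_src byy Y; rewrite shift0 => -[].
  have hy := coding_head Y; rewrite -Ep in hy.
  have E2 : es e = es e' by rewrite -Ee -Ee'.
  congr Some; apply: rk_inj => //; case: (ltngtP (rk e) (rk e')) => // h.
    by have /is_last_rk/(_ (esym E2)) := code_clash hx hy h; lia.
  by have /is_last_rk/(_ E2) := code_clash hy hx h; lia.
have Ey := pedge_None Y; exfalso.
have sv : singular es (src y) by move: byy; rewrite {1}Ey /= => -[].
have nl : ~ is_last e by apply: singular_not_last sv _; rewrite -E.
have := hx (rk e); rewrite Ep Ey coding_nil size_code nth_code eqxx (negbTE (introN idP nl)) /=.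
by rewrite addn1 ltnSn => /(_ isT).
Qed.

Lemma coding_inj x y : bpath x -> bpath y -> src x = src y -> coding x = coding y -> x = y.
Proof.
move=> bx byy E Ep; apply: (gpath_ext E) => i.
elim: i x y bx byy E Ep => [|i IH] x y bx byy E Ep; first exact: coding_inj0.
have E0 := coding_inj0 bx byy E Ep.
case X: (pedge x 0) => [e|]; last first.
  by have Y := X; rewrite E0 in Y; rewrite (pedge_None X) (pedge_None Y).
have Y := X; rewrite E0 in Y.
have lx : len_ge x 1 by apply/len_geS; rewrite X.
have ly : len_ge y 1 by apply/len_geS; rewrite Y.
have := IH _ _ (bpaths_shift bx lx) (bpaths_shift byy ly).
rewrite !pedge_shift addn1; apply.
  by have [_ ->] := pedge_src bx X; have [_ ->] := pedge_src byy Y.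
apply/funext => n; rewrite -!coding_shift Ep (word1 X) (word1 Y) //.
Qed.

(** Let [k] be the position of the first 1. The edge of rank [k] fits, or else a last edge of
    smaller rank, whose code consists of zeros. If [b] has no 1, a last edge fits, and if there is
    none, [v] is an infinite emitter. *)
Lemma decode v (b : nat -> bool) :
  (exists e, es e = v /\ starts (ecode e) b) \/
  (b = (fun=> false) /\ singular es v).
Proof.
have st e k : rk e <= k -> (forall i, i < k -> b i = false) -> is_last e ->
    starts (ecode e) b.
  move=> h hb le i; rewrite size_code nth_code le addn0 => /= h'.
  by apply: hb; apply: leq_trans h' h.
have [[k0 hk]|h0] := pselect (exists k, b k).
  have hmin : forall i, i < ex_minn (ex_intro b k0 hk) -> b i = false.
    move=> i; case: ex_minnP => m bm mm im.
    by apply/negP => /mm; rewrite leqNgt im.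
  have hb : b (ex_minn (ex_intro b k0 hk)) by case: ex_minnP.
  set k := ex_minn _ in hmin hb; left.
  have [[e [E Er]]|[e [E le Er]]] := rank_or_last v k; exists e; split=> //; last first.
    by apply: st hmin le; exact: ltnW.
  case: (boolP (is_last e)) => le; first by apply: st hmin le; rewrite Er.
  move=> i; rewrite size_code nth_code le Er /= addn1 ltnS leq_eqVlt => /orP[/eqP->|h].
    by rewrite hb eqxx.
  by rewrite hmin // ltn_eqF.
have b0 i : b i = false by apply/negP => h; apply: h0; exists i.
have [[e [E le]]|nl] := pselect (exists e, es e = v /\ is_last e).
  by left; exists e; split=> //; apply: st le => //.
right; split; first by apply/funext.
by right; apply: no_last_infinite => e E le; apply: nl; exists e.
Qed.

End Coding.

(** * The coding as a homeomorphism on the paths from a fixed vertex *)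

Section Homeo.
Variables (V Ed : countType) (er es : Ed -> V).
Implicit Types (v : V) (p q : seq Ed) (x y : gpath V Ed).
Local Notation bpath := (bpaths er es).
Local Notation sh := (shift er).
Local Notation src := (psrc es).
Local Notation W := (word es).
Local Notation psi := (coding es).

(* Cylinders and their complements generate the topology of the boundary path
   space, so neighbourhoods are given by finitely many cylinder tests. *)
Definition same (L : seq (V * seq Ed)) x y :=
  forall t, t \in L -> (cyl er es t.1 t.2 x <-> cyl er es t.1 t.2 y).

Lemma cyl_pfx v p x : cyl er es v p x <->
  [/\ bpath x, src x = v, len_ge x (size p) & pfx x (size p) = p].
Proof.
split=> [[bx sx h]|[bx sx lx px]].
  have lx : len_ge x (size p).
    case E: (size p) => [|n]; first by case: x {bx sx h}.
    apply/len_geS; rewrite h ?E //; have := onthTE p n; rewrite E ltnSn.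
    by case: onth.
  split=> //; apply: eq_from_onth_le => i; rewrite size_pfx // maxnn => hi.
  by rewrite onth_pfx // h.
by split=> // i hi; rewrite -{1}px onth_pfx.
Qed.

Lemma cyl_self x m : bpath x -> len_ge x m -> cyl er es (src x) (pfx x m) x.
Proof. by move=> bx lx; apply/cyl_pfx; rewrite size_pfx. Qed.

Lemma ecode0_unique e e' : size (ecode es e) = 0 -> es e' = es e -> e' = e.
Proof.
rewrite size_code => /eqP; rewrite addn_eq0 eqb0 negbK => /andP[/eqP re le] E.
by apply: (rk_inj E); have := is_last_rk le E; rewrite re leqn0 => /eqP.
Qed.

Lemma size_word_ge x i k e : pedge x i = Some e -> i < k -> size (ecode es e) <= size (W x k).
Proof.
move=> E ik; rewrite -(subnKC ik) (wordD er) -[in word es x i.+1]addn1 (wordD er).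
rewrite [X in _ <= X]size_cat [X in _ <= X + _]size_cat.
have -> : W (sh i x) 1 = ecode es e by apply: word1; rewrite pedge_shift.
by lia.
Qed.

Hypothesis cL : condL er es.

(** The edges between [i] and [j] form a cycle. Its exit shows that one of them is not the only edge
    out of its source, and such an edge has a nonempty code. *)
Lemma cycle_code f i j : ipath er es f -> i < j -> es (f i) = es (f j) ->
  exists k, [/\ i <= k, k < j & 0 < size (ecode es (f k))].
Proof.
move=> pf ij E; apply: contrapT => hn.
have h0 k : i <= k -> k < j -> size (ecode es (f k)) = 0.
  by move=> ik kj; apply/eqP; rewrite -leqn0 leqNgt; apply/negP => h; apply: hn; exists k.
have bx : bpath (sh i (PInf f)) by apply: bpaths_shift.
have [fp pe] := @pend_pfx V Ed er es _ (j - i) bx I.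
have [] := cL fp.
- by move/(congr1 size); rewrite size_pfx //=; lia.
- by rewrite pe shiftD /= subnKC ?(ltnW ij) // !add0n E.
move=> e /mapP[k]; rewrite mem_iota add0n => /= hk -> [e' [Ee' ne']].
by apply: ne'; apply: ecode0_unique Ee'; apply: h0; lia.
Qed.

(** If m < n, then [x] is infinite and passes through a cycle between positions [m] and [n], whose
    nonempty code makes the second word strictly longer. A finite path has tails of different
    lengths. *)
Lemma isotropy x m n : bpath x -> len_ge x m -> len_ge x n -> sh m x = sh n x ->
  size (W x m) = size (W x n) -> m = n.
Proof.
wlog: m n / m < n.
  by move=> wl bx lm ln E Es; case: (ltngtP m n) => // h; [apply: wl|symmetry; apply: wl].
move=> mn; case: x => [v p|f] /=.
  by move=> _ lm ln [_ /(congr1 size)]; rewrite !size_drop; lia.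
move=> pf _ _ [E] Es.
have E0 : es (f m) = es (f n) by have := congr1 (@^~ 0) E; rewrite !add0n => ->.
have [k [mk kn]] := cycle_code pf mn E0.
have := @size_word_ge (sh m (PInf f)) (k - m) (n - m) (f k); rewrite pedge_shift /= subnK // => /(_ erefl).
have -> : k - m < n - m by lia.
move=> /(_ isT); have := wordD er es (PInf f) m (n - m); rewrite subnKC ?(ltnW mn) //.
by move=> /(congr1 size); rewrite size_cat -Es /=; lia.
Qed.

Hypothesis nosink : no_sinks es.
Hypothesis nst : no_semi_tails er es.

(** Otherwise all codes are empty from some position on, every later edge is the only one out of its
    source, and the tail is a semi-tail. *)
Lemma word_unbounded f N : ipath er es f -> exists k, N <= size (W (PInf f) k).
Proof.
move=> pf; elim: N => [|N [k Nk]]; first by exists 0.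
suff [i [ki hi]] : exists i, k <= i /\ 0 < size (ecode es (f i)).
  exists (k + (i - k).+1); rewrite (wordD er) size_cat.
  have := @size_word_ge (sh k (PInf f)) (i - k) (i - k).+1 (f i).
  by rewrite pedge_shift /= subnK // => /(_ erefl (ltnSn _)); lia.
apply: contrapT => hn.
have h0 i : k <= i -> size (ecode es (f i)) = 0.
  by move=> ki; apply/eqP; rewrite -leqn0 leqNgt; apply/negP => h; apply: hn; exists i.
apply: (nst (f := fun i => f (i + k))); split; first by move=> i; rewrite pf addSn.
split; last by move=> i e; apply: ecode0_unique; apply: h0; rewrite leq_addl.
(* Wandering: a vertex met infinitely often is met twice, and the cycle in between would contain a
   nonempty code. *)
move=> v; apply: contrapT => ninf.
have [i hi] : exists i, es (f (i + k)) = v.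
  apply: contrapT => ne; apply: ninf; apply: (@sub_finite_set _ _ set0) => //.
  by move=> i /= hi; apply: ne; exists i.
have [j [ij hj]] : exists j, i < j /\ es (f (j + k)) = v.
  apply: contrapT => ne; apply: ninf; apply: (@sub_finite_set _ _ [set` iota 0 i.+1]).
    move=> j /= hj; suff : j \in iota 0 i.+1 by [].
    rewrite mem_iota add0n ltnS /=; case: leqP => // h.
    by exfalso; apply: ne; exists j.
  exact: finite_seq.
have [||c [c1 _]] := @cycle_code f (i + k) (j + k) pf; rewrite ?ltn_add2r ?hi ?hj //.
by rewrite h0 //; apply: leq_trans c1; exact: leq_addl.
Qed.

(** Apply [decode] repeatedly; the path is finite if the process stops and infinite otherwise. *)
Lemma coding_surj v b : exists x, [/\ bpath x, src x = v & psi x = b].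
Proof.
have ex (s : V * (nat -> bool)) : exists o, match o with
    | Some e => es e = s.1 /\ starts (ecode es e) s.2
    | None => s.2 = (fun=> false) /\ singular es s.1 end.
  by have [[e h]|h] := decode nosink s.1 s.2; [exists (Some e)|exists None].
have [D hD] := choice ex.
(* A state is the current vertex with the unread bits; [nxt] reads the code of one edge and stands
   still once [D] stops. *)
pose nxt (s : V * (nat -> bool)) := match D s with
  | Some e => (er e, fun n => s.2 (n + size (ecode es e))) | None => s end.
have fin N s : D (iter N nxt s) = None -> exists x, [/\ bpath x, src x = s.1 & psi x = s.2].
  elim: N s => [|N IH] s.
    move=> /= Ds; have := hD s; rewrite Ds => -[E sv].
    by exists (PFin s.1 [::]); split=> //; rewrite coding_nil E.
  rewrite iterSr; case Ds: (D s) => [e|]; last first.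
    have -> : nxt s = s by rewrite /nxt Ds.
    exact: IH.
  move=> /IH; rewrite /nxt Ds /= => -[x [bx sx px]].
  have := hD s; rewrite Ds => -[Ee st].
  have fp : Defs.fpath er es s.1 [:: e] by rewrite fpath_cons.
  exists (prep s.1 [:: e] x); split.
  - exact: bpaths_prep.
  - exact: (@src_prep _ _ er).
  - by rewrite (@coding_prep _ _ er) // px /ecodes /= cats0 starts_cappE.
have [[N hN]|hn] := pselect (exists N, D (iter N nxt (v, b)) = None); first exact: (fin N (v, b)).
pose st n := iter n nxt (v, b).
have hs n : exists e, D (st n) = Some e.
  by case E: (D (st n)) => [e|]; [exists e|exfalso; apply: hn; exists n].
have [f hf] := choice hs.
have hst n : st n.+1 = (er (f n), fun i => (st n).2 (i + size (ecode es (f n)))).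
  by rewrite /st iterS -/(st n) {1}/nxt hf.
have hfn n : es (f n) = (st n).1 /\ starts (ecode es (f n)) (st n).2.
  by have := hD (st n); rewrite hf.
have pf : ipath er es f by move=> n; have [-> _] := hfn n.+1; rewrite hst.
exists (PInf f); split=> //=; first by have [->] := hfn 0.
(* [b] is the word of the first [k] edges followed by the unread bits; these words eventually cover
   every position. *)
have key k : b = capp (W (PInf f) k) (st k).2.
  elim: k => [|k IH]; first by apply/funext => i; rewrite /capp /= subn0.
  rewrite {1}IH -addn1 (wordD er) addn1 hst /=.
  have -> : W (sh k (PInf f)) 1 = ecode es (f k) by apply: word1.
  have [_ /starts_cappE h] := hfn k; rewrite -{1}h; apply/funext => i.
  rewrite /capp nth_cat size_cat; case: ltnP => h1; first by rewrite ltn_addr.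
  by rewrite -(ltn_add2l (size (W (PInf f) k))) subnKC //; case: ltnP => // h2; rewrite subnDA.
apply/funext => n; have [k hk] := word_unbounded n.+1 pf.
by rewrite (coding_starts er hk) (key k) (starts_capp _ hk).
Qed.

(** Openness: follow [x0] for some edges, then decode the remaining bits of [b] from the vertex
    reached. *)
Lemma coding_open x0 L : bpath x0 -> exists N, forall b, (forall i, i < N -> b i = psi x0 i) ->
  exists x, [/\ bpath x, src x = src x0, psi x = b & same L x0 x].
Proof.
move=> bx0.
pose k := \max_(t <- L) size t.2.
have kL t : t \in L -> size t.2 <= k by move=> tL; exact: leq_bigmax_seq.
have glue m (b : nat -> bool) : len_ge x0 m -> starts (W x0 m) b -> exists t,
    [/\ bpath t, src t = src (sh m x0) & psi t = (fun n => b (n + size (W x0 m)))] /\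
    [/\ bpath (prep (src x0) (pfx x0 m) t), src (prep (src x0) (pfx x0 m) t) = src x0 &
    psi (prep (src x0) (pfx x0 m) t) = b].
  move=> lx sb; have [t [bt st pt]] := coding_surj (src (sh m x0)) (fun n => b (n + size (W x0 m))).
  have [fp pe] := pend_pfx bx0 lx; exists t; do 2![split=> //].
  - by apply: bpaths_prep => //; rewrite pe.
  - by apply: (@src_prep _ _ er) => //; rewrite pe.
  - by rewrite (@coding_prep _ _ er) ?pe // pt starts_cappE.
(* If [x0] has at least [k] edges, a path from the same source with the same first [k] edges passes
   the same tests. *)
have [lk|nlk] := pselect (len_ge x0 k).
  exists (size (W x0 k)) => b hb.
  have [|t [[bt st pt] [bp sp pp]]] := glue k b lk.
    by move=> i hi; rewrite hb // (coding_starts er hi).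
  exists (prep (src x0) (pfx x0 k) t); split=> // u uL.
  have E i : i < size u.2 -> pedge (prep (src x0) (pfx x0 k) t) i = pedge x0 i.
    move=> /leq_trans/(_ (kL _ uL)) ik; rewrite pedge_prep size_pfx // ik onth_pfx //.
  split=> -[_ s1 s2]; (split=> // [|i hi]; first by rewrite -s1 sp).
    by rewrite E // s2.
  by rewrite -E // s2.
case: x0 bx0 glue nlk => [v p|f]; last by move=> _ _; case.
(* Otherwise [x0] ends at a singular vertex. [M] further zeros force any continuation to begin with
   an edge of rank at least [M], and such an edge occurs in none of the tests. *)
move=> bx0 glue nlk; pose M := (\max_(e <- flatten [seq t.2 | t <- L]) rk es e).+1.
exists (size (W (PFin v p) (size p)) + M) => b hb.
have lp : len_ge (PFin v p) (size p) by exact: leqnn.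
have [|t [[bt st pt] [bp sp pp]]] := glue (size p) b lp.
  by move=> i hi; rewrite hb ?ltn_addr // (coding_starts er hi).
exists (prep v (pfx (PFin v p) (size p)) t); split=> // u uL.
have pb : pfx (PFin v p) (size p) = p by rewrite /= take_size.
have shp : sh (size p) (PFin v p) = PFin (pend er v p) [::] by rewrite /= take_size drop_size.
have p0 i : i < M -> psi t i = false.
  move=> iM; rewrite pt hb; last by rewrite addnC ltn_add2l.
  by rewrite (coding_shift er) shp coding_nil.
have t0 e : pedge t 0 = Some e -> M <= rk es e.
  move=> te; rewrite leqNgt; apply/negP => /p0.
  have nl : ~ is_last es e.
    apply: (@singular_not_last _ _ _ (pend er v p)); first by case: bx0.
    by have := pedge_src bt te; rewrite shift0 st shp => -[].
  rewrite (coding_head er te); last by rewrite size_code (introN idP nl) addn1.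
  by rewrite nth_code eqxx (introN idP nl).
have E i : i < size p -> pedge (prep v p t) i = pedge (PFin v p) i.
  by move=> ip; rewrite pedge_prep ip.
rewrite pb in sp bp *.
split=> -[_ s1 s2]; (split=> // [|i hi]; first by rewrite -s1 sp).
  case: (ltnP i (size p)) => ip; first by rewrite E // s2.
  by have := s2 _ hi; rewrite /= onth_default // => h; have := onthTE u.2 i; rewrite -h hi.
case: (ltnP i (size p)) => ip; first by rewrite -E // s2.
exfalso; have hp : size p < size u.2 by exact: leq_ltn_trans hi.
have := s2 _ hp; rewrite pedge_prep ltnn subnn.
case U: (onth u.2 (size p)) => [e|]; last by have := onthTE u.2 (size p); rewrite U hp.
move=> /t0; rewrite leqNgt ltnS => /negP; apply; apply: leq_bigmax_seq => //.
apply/flattenP; exists u.2; first by apply/mapP; exists u.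
by apply/onthP; exists (size p).
Qed.

(** Continuity: for an infinite [x0], one test on a prefix whose word has at least [N] bits
    suffices. For a finite [x0] the tests exclude the edges of rank below [N] at its end, so any
    continuation starts with [N] zeros. *)
Lemma coding_cont x0 N : bpath x0 -> exists L, forall x, bpath x -> same L x0 x ->
  forall i, i < N -> psi x i = psi x0 i.
Proof.
case: x0 => [v p|f] bx0; last first.
  have [k hk] := word_unbounded N bx0.
  exists [:: (es (f 0), @pfx V Ed (PInf f) k)] => x bx /(_ _ (mem_head _ _)) /= -[h _] i hi.
  have /cyl_pfx[_ _] := h (cyl_self bx0 (I : @len_ge V Ed (PInf f) k)).
  rewrite size_mkseq => lx px; have E : W x k = W (PInf f) k by rewrite /word px.
  have hik : i < size (W (PInf f) k) by apply: leq_trans hk.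
  rewrite [RHS](coding_starts er hik) -E; apply: (coding_starts er); by rewrite E.
have ex k : exists o, match o with Some e => es e = pend er v p /\ rk es e = k
    | None => ~ exists e, es e = pend er v p /\ rk es e = k end.
  by have [[e h]|h] := pselect (exists e, es e = pend er v p /\ rk es e = k);
    [exists (Some e)|exists None].
have [g hg] := choice ex.
exists ((v, p) :: [seq (v, rcons p e) | e <- pmap g (iota 0 N)]) => x bx sm i hi.
have cp0 : cyl er es v p (PFin v p) by split.
have /cyl_pfx[_ sx lx px] : cyl er es v p x by apply/(sm _ (mem_head _ _)).
have Wp : W (PFin v p) (size p) = W x (size p) by rewrite /word px /= take_size.
rewrite (coding_capp er _ _ (size p)) (coding_capp er _ (PFin v p) (size p)) Wp /capp.
case: ltnP => // h; have -> : sh (size p) (PFin v p) = PFin (pend er v p) [::].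
  by rewrite /= take_size drop_size.
rewrite coding_nil; set t := sh (size p) x; set j := i - _.
have jN : j < N by rewrite /j; lia.
have bt : bpath t by exact: bpaths_shift.
case T: (pedge t 0) => [e|]; last by rewrite (pedge_None es T) coding_nil.
have lt : len_ge t 1 by apply/len_geS; rewrite T.
have Ee : es e = pend er v p.
  have := pedge_src bt T; rewrite shift0 => -[<- _].
  by have [_] := pend_pfx bx lx; rewrite px sx => ->.
have re : N <= rk es e.
  rewrite leqNgt; apply/negP => rN; have := hg (rk es e).
  case G: (g (rk es e)) => [e'|]; last by case; exists e.
  move=> [Ee' Er]; have E : e' = e by apply: rk_inj Er; rewrite Ee Ee'.
  rewrite {}E in G.
  have /sm[_] /= : (v, rcons p e) \in (v, p) :: [seq (v, rcons p e) | e <- pmap g (iota 0 N)].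
    rewrite inE; apply/orP; right; apply/mapP; exists e => //.
    by rewrite mem_pmap; apply/mapP; exists (rk es e); rewrite ?mem_iota.
  case.
    apply/cyl_pfx; rewrite size_rcons -addn1; split=> //.
      exact: len_ge_shiftV lt.
    rewrite (pfxD er) px -cats1; congr cat.
    by apply: eq_from_onth_le => -[|k]; rewrite (size_pfx lt) // onth_pfx.
  move=> _ _ /(_ (size p)); rewrite size_rcons ltnSn /= => /(_ isT).
  by rewrite onth_default // -cats1 onth_cat ltnn subnn.
have sj : j < size (ecode es e) by rewrite size_code; apply: leq_trans (leq_addr _ _); exact: leq_trans re.
by rewrite (coding_head er T sj) nth_code andbC ltn_eqF //; exact: leq_trans re.
Qed.

End Homeo.

(** * Finite intersections of subbasic sets *)

Section FsetSeq.
Import mathcomp.finmap.finmap.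

(** Replaces the finite index set of an intersection by a list, on which induction is possible. *)
Lemma bigcap_fset (K : choiceType) (U : Type) (D : {fset K}) (f : K -> set U) B :
  \bigcap_(i in [set` D]) f i = B ->
  exists2 s : seq K, (forall i, i \in s -> i \in D) &
    [set u | forall i, i \in s -> f i u] = B.
Proof. by move=> <-; exists D. Qed.

End FsetSeq.

(** * Topology of the boundary path space *)

Section BoundaryTopology.
Variables (V Ed : countType) (er es : Ed -> V).
Local Notation bpath := (bpaths er es).
Local Notation sh := (shift er).
Local Notation src := (psrc es).
Local Notation X := (bspace er es).
Implicit Types (v : V) (p q : seq Ed) (x y : X).

Lemma open_pointwise (T : topologicalType) (A : set T) :
  (forall a, A a -> exists O, [/\ open O, O a & O `<=` A]) -> open A.
Proof.
move=> h; rewrite openE => a /h[O [oO Oa OA]]; apply: (filterS OA).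
exact: open_nbhs_nbhs.
Qed.

Lemma open_base v p (F : seq Ed) : Defs.fpath er es v p ->
  (forall e, e \in F -> es e = pend er v p) ->
  open ([set x | cyl er es v p x /\ forall e, e \in F -> ~ cyl er es v (rcons p e) x] : set X).
Proof.
move=> fp hF; set B := (X in open X).
exists [set B]; last by rewrite bigcup_set1.
move=> _ ->; exists (finmap.fset1 B); last by rewrite set_fset1 bigcap_set1.
by move=> C; rewrite finmap.in_fset1 => /eqP ->; rewrite inE; exists v, p, F.
Qed.

Lemma cyl_fpath v p x : cyl er es v p x -> Defs.fpath er es v p.
Proof. by move=> /cyl_pfx[bx <- lx <-]; have [] := pend_pfx bx lx. Qed.

Lemma cyl_rcons v p e x : cyl er es v (rcons p e) x -> cyl er es v p x.
Proof.
move=> [bx sx h]; split=> // i hi.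
by rewrite h ?size_rcons ?ltnS 1?ltnW // -cats1 onth_cat hi.
Qed.

Lemma cyl_open v p : open (cyl er es v p : set X).
Proof.
have [fp|nfp] := pselect (Defs.fpath er es v p); last first.
  rewrite (_ : cyl _ _ _ _ = set0); first exact: open0.
  by apply/seteqP; split=> // x /cyl_fpath.
have := @open_base v p [::] fp; rewrite (_ : [set _ | _] = cyl er es v p); first by apply.
by apply/seteqP; split=> x; [case|split].
Qed.

Lemma bpaths_open : open (bpath : set X).
Proof.
apply: open_pointwise => x bx; exists (cyl er es (src x) [::]); split.
- exact: cyl_open.
- by split.
- by move=> y [].
Qed.

(** Induction on the last edge [e]. Paths outside the cylinder of the shorter word are covered by
    induction; inside it, excluding [e] is a basic open condition, and no condition at all if [e]
    does not leave the endpoint. *)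
Lemma cylC_open v p : open ([set x | bpath x /\ ~ cyl er es v p x] : set X).
Proof.
elim/last_ind: p => [|p e IH].
  apply: open_pointwise => x [bx nx]; exists (cyl er es (src x) [::]); split.
  - exact: cyl_open.
  - by split.
  - by move=> y [byy sy _]; split=> // -[_ sv _]; apply: nx; split=> //; rewrite -sv.
apply: open_pointwise => x [bx nx].
have [cx|ncx] := pselect (cyl er es v p x); last first.
  exists [set x | bpath x /\ ~ cyl er es v p x]; split=> // y [byy ny]; split=> //.
  by move=> /cyl_rcons.
have fp := cyl_fpath cx.
have [Ee|nEe] := pselect (es e = pend er v p).
  exists [set x | cyl er es v p x /\ forall e', e' \in [:: e] -> ~ cyl er es v (rcons p e') x].
  split.
  - by apply: open_base => // e'; rewrite inE => /eqP ->.
  - by split=> // e'; rewrite inE => /eqP ->.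
  - by move=> y [[byy sy h] /(_ e (mem_head _ _))].
exists (cyl er es v p); split=> //; first exact: cyl_open.
move=> y [byy _ _]; split=> // /cyl_fpath; rewrite -cats1 fpath_cat => -[_].
by rewrite fpath_cons => -[].
Qed.

Lemma same_cat L L' x y : same er es (L ++ L') x y <-> same er es L x y /\ same er es L' x y.
Proof.
split=> [h|[h h'] t]; last by rewrite mem_cat => /orP[/h|/h'].
by split=> t tL; apply: h; rewrite mem_cat tL ?orbT.
Qed.

Lemma same_open L x : open ([set y | bpath y /\ same er es L x y] : set X).
Proof.
elim: L => [|t L IH].
  rewrite (_ : [set _ | _] = bpath); first exact: bpaths_open.
  by apply/seteqP; split=> y //; case.
have ot : open ([set y | bpath y /\ (cyl er es t.1 t.2 x <-> cyl er es t.1 t.2 y)] : set X).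
  have [cx|ncx] := pselect (cyl er es t.1 t.2 x).
    rewrite (_ : [set _ | _] = cyl er es t.1 t.2); first exact: cyl_open.
    by apply/seteqP; split=> y => [[_ [h _]]|cy]; [exact: h|split=> //; case: cy].
  rewrite (_ : [set _ | _] = [set y | bpath y /\ ~ cyl er es t.1 t.2 y]); first exact: cylC_open.
  by apply/seteqP; split=> y [byy h]; split=> //; tauto.
have := openI ot IH; rewrite (_ : _ `&` _ = [set y | bpath y /\ same er es (t :: L) x y]) //.
apply/seteqP; split=> y.
  by move=> [[byy h] [_ h']]; split=> // u; rewrite inE => /orP[/eqP->|/h'].
move=> [byy h]; split; split=> //; first by apply: h; rewrite mem_head.
by move=> u uL; apply: h; rewrite inE uL orbT.
Qed.

(** With [same_open] this makes finite lists of tests a neighbourhood base. A basic set contributes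
    the test for [p] and those for its extensions by the excluded edges. *)
Lemma open_same (U : set X) x : open U -> U x -> exists L, forall y, bpath y ->
  same er es L x y -> U y.
Proof.
move=> [D' sD <-] [B D'B Bx]; have [D fD EB] := sD B D'B.
have [s' sD' Es] := bigcap_fset EB.
pose s : seq (set X) := s'.
have bases C : C \in s -> bpath_base er es C by move=> /sD'/fD; rewrite inE.
have EB' : [set y | forall C, C \in s -> C y] = B by exact: Es.
have key (l : seq (set X)) : {subset l <= s} -> exists L, forall y, bpath y ->
    same er es L x y -> forall C, C \in l -> C y.
  elim: l => [|C l IH] sl; first by exists [::].
  have [|L hL] := IH; first by move=> C' h; apply: sl; rewrite inE h orbT.
  have CD : C \in s by apply: sl; rewrite mem_head.
  have [v [p [F [fp hF EC]]]] := bases C CD.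
  exists (((v, p) :: [seq (v, rcons p e) | e <- F]) ++ L) => y byy /same_cat[h h'] C'.
  rewrite inE => /orP[/eqP ->|]; last exact: hL.
  have : C x by move: Bx => /=; rewrite -EB'; apply.
  rewrite EC => -[cx nx]; split; first by apply/(h (v, p) (mem_head _ _)).
  move=> e eF cy; apply: (nx e eF); apply/(h (v, rcons p e)) => //.
  by rewrite inE; apply/orP; right; apply/mapP; exists e.
have [//|L hL] := key s.
by exists L => y byy sy; exists B => //; rewrite /= -EB' => C; exact: hL.
Qed.

End BoundaryTopology.

(** * The graph groupoid: lags and bisections *)

Section GraphGroupoidTopology.
Variables (V Ed : countType) (er es : Ed -> V).
Local Notation bpath := (bpaths er es).
Local Notation sh := (shift er).
Local Notation src := (psrc es).
Local Notation X := (bspace er es).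
Local Notation G := (GEtype er es).
Implicit Types (v : V) (p q : seq Ed) (x y z : X) (g h : G).
Local Open Scope ring_scope.

(** Keeps the exponents [m] and [n], of which the groupoid element only records the difference. *)
Definition tail_eq x (m n : nat) y :=
  [/\ bpath x, bpath y, len_ge x m, len_ge y n & sh m x = sh n y].

Lemma tail_eq0 x : bpath x -> tail_eq x 0 0 x.
Proof. by move=> bx; split=> //; case: x bx. Qed.

Lemma GEcarP g : GEcar er es g <->
  exists m n : nat, tail_eq g.1.1 m n g.2 /\ g.1.2 = m%:Z - n%:Z.
Proof.
split=> [[x [y [m [n [[bx by_ lx ly] [E ->]]]]]]|]; first by exists m, n.
case: g => -[x k] y [m [n [[/= bx by_ lx ly E] ->]]].
by exists x, y, m, n.
Qed.

Lemma tail_eqD x m n y d : tail_eq x m n y -> len_ge (sh m x) d -> tail_eq x (m + d) (n + d) y.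
Proof.
move=> [bx by_ lx ly E] ld; split=> //.
- exact: len_ge_shiftV ld.
- by apply: (@len_ge_shiftV _ _ er _ _ _ ly); rewrite -E.
- by rewrite -!shiftD E.
Qed.

(** The relation with the smaller exponent at [y] is shifted further until both exponents at [y]
    agree. *)
Lemma tail_eq_trans x y z (m n m' n' : nat) : tail_eq x m n y -> tail_eq y m' n' z ->
  exists a b : nat, tail_eq x a b z /\ a%:Z - b%:Z = (m%:Z - n%:Z) + (m'%:Z - n'%:Z).
Proof.
have key a b c d e f : tail_eq a b c d -> tail_eq d c e f -> tail_eq a b e f.
  by move=> [ba bd la ld E] [_ bf _ lf E']; split=> //; rewrite E.
move=> h h'; case: (leqP n m') => nm.
  exists (m + (m' - n))%N, n'; split; last by lia.
  have h2 : tail_eq x (m + (m' - n)) (n + (m' - n)) y.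
    apply: tail_eqD (h) _; case: h h' => [_ _ _ _ ->] [_ _ ly _ _].
    by apply: len_ge_shift; rewrite subnKC.
  by rewrite subnKC // in h2; exact: key h2 h'.
exists m, (n' + (n - m'))%N; split; last by lia.
have h2 : tail_eq y (m' + (n - m')) (n' + (n - m')) z.
  apply: tail_eqD (h') _; case: h => [_ _ _ ly _].
  by apply: len_ge_shift; rewrite subnKC // ltnW.
by rewrite subnKC ?(ltnW nm) // in h2; exact: key h h2.
Qed.

Lemma GEcar_mul g h : GEcar er es g -> GEcar er es h -> g.2 = h.1.1 ->
  GEcar er es (GE_mul g h).
Proof.
move=> /GEcarP[m [n [hg Eg]]] /GEcarP[m' [n' [hh Eh]]] E; rewrite E in hg.
have [a [b [hab Eab]]] := tail_eq_trans hg hh.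
by apply/GEcarP; exists a, b; split=> //; rewrite Eab /= Eg Eh.
Qed.

Lemma GEcar_inv g : GEcar er es g -> GEcar er es (GE_inv g).
Proof.
move=> /GEcarP[m [n [[bx by_ lx ly E] Eg]]]; apply/GEcarP; exists n, m; split=> //.
by rewrite /= Eg opprB.
Qed.

Lemma GEcar_unit x : bpath x -> GEcar er es (x, 0, x).
Proof. by move=> bx; apply/GEcarP; exists 0%N, 0%N; split=> //; exact: tail_eq0. Qed.

Lemma unitsE g : units (graph_groupoid er es) g <-> bpath g.1.1 /\ g = (g.1.1, 0, g.1.1).
Proof.
split=> [[/GEcarP[m [n [[bx _ _ _ _] _]]] E]|[bx E]]; first by split=> //; rewrite {1}[g in LHS]E.
by split=> [|/=]; [rewrite E; exact: GEcar_unit | rewrite [RHS]E].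
Qed.

(* The difference of the two code lengths is eventually constant along the common
   tail, which makes the lag independent of the choice of m and n. *)
Definition lag_of g (l : int) := exists N : nat, forall a b : nat, (N <= a)%N -> (N <= b)%N ->
  a%:Z - b%:Z = g.1.2 -> l = (size (word es g.1.1 a))%:Z - (size (word es g.2 b))%:Z.

Definition lag g : int := xget 0 (lag_of g).

Lemma lag_of_tail x (m n : nat) y : tail_eq x m n y ->
  lag_of (x, m%:Z - n%:Z, y) ((size (word es x m))%:Z - (size (word es y n))%:Z).
Proof.
move=> [_ _ _ _ E]; exists (m + n)%N => a b ma nb /= hab.
have [d Ea Eb] : exists2 d : nat, a = (m + d)%N & b = (n + d)%N.
  by exists (a - m)%N; lia.
by rewrite Ea Eb !(wordD er) !size_cat E; lia.
Qed.

Lemma lag_of_uniq g l l' : lag_of g l -> lag_of g l' -> l = l'.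
Proof.
case: g => -[x k] y [N hN] [N' hN'] /=.
(* A pair of exponents with difference [k] beyond both thresholds. *)
pose a := (N + N' + `|k|)%N; pose b := `|a%:Z - k|%N.
by rewrite (hN a b) ?(hN' a b) //= /b /a; lia.
Qed.

Lemma lag_eq g l : lag_of g l -> lag g = l.
Proof.
by move=> h; apply: (@lag_of_uniq g) => //; apply: (xgetPex 0); exists l.
Qed.

Lemma lagE x (m n : nat) y : tail_eq x m n y ->
  lag (x, m%:Z - n%:Z, y) = (size (word es x m))%:Z - (size (word es y n))%:Z.
Proof. by move=> h; apply/lag_eq/lag_of_tail. Qed.

Lemma lag_ofP g : GEcar er es g -> lag_of g (lag g).
Proof.
case: g => -[x k] y /GEcarP[m [n [h /= ->]]].
by rewrite lagE //; exact: lag_of_tail.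
Qed.

Lemma lagM g h : GEcar er es g -> GEcar er es h -> g.2 = h.1.1 ->
  lag (GE_mul g h) = lag g + lag h.
Proof.
move=> /lag_ofP[N hN] /lag_ofP[N' hN'] E; apply: lag_eq.
exists (N + N' + `|g.1.2|)%N => a b ha hb /= hab.
(* The exponent at the middle path; the absolute value in the bound keeps it above both
   thresholds. *)
pose c := `|a%:Z - g.1.2|%N.
rewrite (hN a c) ?(hN' c b) ?E /c; lia.
Qed.

(* Uses that a cycle with an exit has a nonempty code. *)
Lemma lag_isotropy x k : condL er es -> GEcar er es (x, k, x) -> lag (x, k, x) = 0 -> k = 0.
Proof.
move=> cL /GEcarP[m [n [h /= E]]]; rewrite E lagE // => /eqP; rewrite subr_eq0 => /eqP[Ew].
case: h => bx _ lm ln Es.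
by rewrite (isotropy cL bx lm ln Es Ew) subrr.
Qed.

Lemma open_GEbase (W : set G) : GEbase er es W -> open W.
Proof.
move=> hW; exists [set W]; last by rewrite bigcup_set1.
move=> _ ->; exists (finmap.fset1 W); last by rewrite set_fset1 bigcap_set1.
by move=> C; rewrite finmap.in_fset1 => /eqP ->; rewrite inE.
Qed.

Lemma open_diag (U : set X) : open U -> U `<=` bpath ->
  open ([set g | exists2 x, U x & g = (x, 0, x)] : set G).
Proof.
move=> oU bU; set W := (W in open W).
apply: open_GEbase; exists 0%N, 0%N, U, U; split; first by split.
split; first by split=> -[].
split=> //; try by move=> a b _ _; rewrite !shift0.
apply/seteqP; split=> g; first by move=> [x Ux ->]; exists x, x.
by move=> [x [y [Ux Uy]]]; rewrite !shift0 => -> ->; exists y; rewrite ?subrr.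
Qed.

Lemma open_units_GE : open (units (graph_groupoid er es)).
Proof.
rewrite (_ : units _ = ([set g | exists2 x, bpath x & g = (x, 0, x)] : set G)).
  by apply: open_diag => //; exact: bpaths_open.
apply/seteqP; split=> g; first by move=> /unitsE[bg ->]; exists g.1.1.
by move=> [x bx ->]; apply/unitsE.
Qed.

(** One element can be presented with different pairs of exponents. Raising them is a further shift;
    lowering them compares edges before positions [m] and [n], which [x'] and [y'] share with [x]
    and [y]. *)
Lemma tail_eq_agree x y x' y' (m n m' n' : nat) :
  tail_eq x m n y -> tail_eq x m' n' y -> m%:Z - n%:Z = m'%:Z - n'%:Z ->
  tail_eq x' m n y' -> pfx x' m = pfx x m -> pfx y' n = pfx y n ->
  sh m' x' = sh n' y'.
Proof.
move=> [_ _ lx ly E] [bx by_ _ _ E'] Ek [bx' by' lx' ly' E2] Px Py.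
case: (leqP m m') => mm.
  have [d [-> ->]] : exists d, m' = (m + d)%N /\ n' = (n + d)%N by exists (m' - m)%N; lia.
  by rewrite -!shiftD E2.
have Ep i : pedge (sh m' x') i = pedge (sh n' y') i.
  rewrite !pedge_shift; case: (ltnP (i + m') m) => im.
    have in_ : (i + n' < n)%N by lia.
    rewrite -(onth_pfx x' im) Px (onth_pfx _ im) -(onth_pfx y' in_) Py (onth_pfx _ in_).
    by have := congr1 (fun z => pedge z i) E'; rewrite !pedge_shift.
  have -> : (i + m' = i + m' - m + m)%N by lia.
  have -> : (i + n' = i + m' - m + n)%N by lia.
  by have := congr1 (fun z => pedge z (i + m' - m)%N) E2; rewrite !pedge_shift.
(* As m' < m, both tails have a first edge; it is the same edge and determines their source. *)
apply: (gpath_ext (es := es)) => //.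
have /len_geS : len_ge x' m'.+1 by apply: len_geW lx'.
case Ee : (pedge x' m') => [e|] // _.
have := Ep 0%N; rewrite !pedge_shift !add0n Ee => /esym Ee'.
by have [-> _] := pedge_src bx' Ee; have [-> _] := pedge_src by' Ee'.
Qed.

(** A neighbourhood can be tested with the chosen exponents: a subbasic set may use others with the
    same difference, and [tail_eq_agree] translates once two extra tests fix the prefixes. *)
Lemma open_GE (O : set G) x (m n : nat) y : open O -> tail_eq x m n y ->
  O (x, m%:Z - n%:Z, y) -> exists L, forall x' y', tail_eq x' m n y' ->
    same er es L x x' -> same er es L y y' -> O (x', m%:Z - n%:Z, y').
Proof.
move=> [D' sD <-] txy [B D'B Bx]; have [D fD EB] := sD B D'B.
have [s' sD' Es] := bigcap_fset EB.
pose s : seq (set G) := s'.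
have bases C : C \in s -> GEbase er es C by move=> /sD'/fD; rewrite inE.
have EB' : [set g | forall C, C \in s -> C g] = B by exact: Es.
have key (l : seq (set G)) : {subset l <= s} -> exists L, forall x' y', tail_eq x' m n y' ->
    same er es L x x' -> same er es L y y' -> forall C, C \in l -> C (x', m%:Z - n%:Z, y').
  elim: l => [|C l IH] sl; first by exists [::].
  have [|L hL] := IH; first by move=> C' h; apply: sl; rewrite inE h orbT.
  have CD : C \in s by apply: sl; rewrite mem_head.
  have : C (x, m%:Z - n%:Z, y) by move: Bx => /=; rewrite -EB'; apply.
  have [m' [n' [U [U' [[oU oU' bU bU'] [[lU lU'] [_ _ _ ->]]]]]]] := bases C CD.
  move=> [x0 [y0 [Ux Uy E [Ex Ek Ey]]]]; rewrite -{x0}Ex -{y0}Ey in Ux Uy E.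
  have [L1 hL1] := open_same oU Ux; have [L2 hL2] := open_same oU' Uy.
  exists (((src x, pfx x m) :: (src y, pfx y n) :: L1 ++ L2) ++ L) => x' y' t' /same_cat[sx sx'] /same_cat[sy sy'] C'.
  rewrite inE => /orP[/eqP ->|]; last exact: hL.
  have [bx by_ lx ly _] := txy; have [bx' by' _ _ _] := t'.
  have Ux' : U x'.
    by apply: hL1 => // t tL; apply: sx; rewrite !inE mem_cat tL !orbT.
  have Uy' : U' y'.
    by apply: hL2 => // t tL; apply: sy; rewrite !inE mem_cat tL !orbT.
  exists x', y'; split=> //; last by rewrite Ek.
  apply: (@tail_eq_agree x y x' y' m n) => //.
  - by split=> //; [exact: lU | exact: lU'].
  - have /cyl_pfx[_ _ _] : cyl er es (src x) (pfx x m) x'.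
      by apply/(sx (src x, pfx x m)); rewrite ?mem_head //; exact: cyl_self.
    by rewrite size_pfx.
  - have /cyl_pfx[_ _ _] : cyl er es (src y) (pfx y n) y'.
      by apply/(sy (src y, pfx y n)); rewrite ?inE ?eqxx ?orbT //; exact: cyl_self.
    by rewrite size_pfx.
have [//|L hL] := key s.
exists L => x' y' t' sx sy; exists B => //; rewrite /= -EB' => C; exact: hL.
Qed.

(* Continuity of the prefix exchange mu t |-> nu t. *)
Lemma same_transport x (m n : nat) y L : tail_eq x m n y -> exists L', forall x' y',
  tail_eq x' m n y' -> src y' = src y -> pfx y' n = pfx y n -> same er es L' x x' -> same er es L y y'.
Proof.
(* A test [p] on the [y] side turns into one on the [x] side by exchanging its first [n] edges for
   the prefix of [x]; positions below [n] are settled by the common prefix of [y1] and [y2]. *)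
have half x1 y1 x2 y2 v p : tail_eq x1 m n y1 -> tail_eq x2 m n y2 ->
    src y2 = src y1 -> pfx y2 n = pfx y1 n -> src x1 = src x -> pfx x1 m = pfx x m ->
    tail_eq x m n y ->
    (cyl er es (src x) (pfx x m ++ drop n p) x1 -> cyl er es (src x) (pfx x m ++ drop n p) x2) ->
    cyl er es v p y1 -> cyl er es v p y2.
  move=> [bx1 by1 lx1 ly1 E1] [bx2 by2 lx2 ly2 E2] Es Ep Sx Px [_ _ lx _ _] h [_ sy h1].
  split=> // [|i hi]; first by rewrite Es.
  case: (ltnP i n) => ni; first by rewrite -(onth_pfx _ ni) Ep onth_pfx // h1.
  have k1 j : pedge x1 (j + m) = pedge y1 (j + n).
    by have := congr1 (fun z => pedge z j) E1; rewrite !pedge_shift.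
  have k2 j : pedge x2 (j + m) = pedge y2 (j + n).
    by have := congr1 (fun z => pedge z j) E2; rewrite !pedge_shift.
  have [|_ _ h2] := h.
    split=> // j; rewrite size_cat size_drop size_pfx // onth_cat size_pfx // => hj.
    case: ltnP => jm; first by rewrite -Px onth_pfx.
    rewrite -{1}(subnK jm) k1 h1; last by lia.
    by rewrite -{1}(cat_take_drop n p) onth_cat size_takel ?ltnNge ?leq_addl ?addnK //=; lia.
  have hh : (i - n + m < size (pfx x m ++ drop n p))%N.
    by rewrite size_cat size_drop size_pfx //; lia.
  have := h2 _ hh; rewrite onth_cat size_pfx // ltnNge leq_addl /= addnK k2 subnK // => ->.
  by rewrite -{2}(cat_take_drop n p) onth_cat size_takel ?ltnNge ?ni //; lia.
move=> txy; have [bx _ lx _ _] := txy.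
exists ((src x, pfx x m) :: [seq (src x, pfx x m ++ drop n t.2) | t <- L]).
move=> x' y' t' sy py sm t tL.
have /cyl_pfx[_ sx' _] : cyl er es (src x) (pfx x m) x'.
  by apply/(sm (src x, pfx x m)); rewrite ?mem_head //; exact: cyl_self.
rewrite size_pfx // => px'.
have hi : (src x, pfx x m ++ drop n t.2) \in (src x, pfx x m) :: [seq (src x, pfx x m ++ drop n t.2) | t <- L].
  by rewrite inE; apply/orP; right; apply/mapP; exists t.
have [s1 s2] := sm _ hi.
split; first exact: (half x y x' y').
by apply: (half x' y' x y).
Qed.

(** Write x = mu t and y = nu t with mu, nu of lengths [m], [n]. A path x' = mu t' near [x] gets the
    partner y' = nu t', which is near [y] by [same_transport]. *)
Lemma local_bisection (O : set G) x (m n : nat) y : open O -> tail_eq x m n y ->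
  O (x, m%:Z - n%:Z, y) -> exists L, forall x', bpath x' -> same er es L x x' ->
  exists y', [/\ tail_eq x' m n y', pfx x' m = pfx x m, pfx y' n = pfx y n & O (x', m%:Z - n%:Z, y')].
Proof.
move=> oO txy Oxy; have [L hL] := open_GE oO txy Oxy.
have [L' hL'] := same_transport L txy.
exists ((src x, pfx x m) :: L ++ L') => x' bx' sm.
have [bx by_ lx ly E] := txy.
have /cyl_pfx[_ sx'] : cyl er es (src x) (pfx x m) x'.
  by apply/(sm (src x, pfx x m)); rewrite ?mem_head //; exact: cyl_self.
rewrite size_pfx // => lx' px'.
have [fp pe] := pend_pfx by_ ly.
have Et : src (sh m x') = pend er (src y) (pfx y n).
  have [_ <-] := pend_pfx bx' lx'; have [_ pex] := pend_pfx bx lx.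
  by rewrite sx' px' pex pe E.
have btx := bpaths_shift bx' lx'.
pose y' : X := prep (src y) (pfx y n) (sh m x').
have t' : tail_eq x' m n y'.
  split=> //; first exact: bpaths_prep.
    by have := len_ge_prep (src y) (pfx y n) (sh m x'); rewrite size_pfx.
  by have := shift_prep (p := pfx y n) Et; rewrite size_pfx.
have py : pfx y' n = pfx y n by have := pfx_prep (src y) (pfx y n) (sh m x'); rewrite size_pfx.
have sy : src y' = src y by exact: (src_prep fp Et).
exists y'; split=> //; apply: hL => //.
  by move=> t tL; apply: sm; rewrite inE mem_cat tL !orbT.
apply: hL' t' sy py _.
by move=> t tL; apply: sm; rewrite inE mem_cat tL !orbT.
Qed.

End GraphGroupoidTopology.

(** * Subspaces, compactness and locally constant partitions *)

Section TopologyFacts.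
Local Open Scope classical_set_scope.

Lemma within_open (T U : topologicalType) (A : set T) (f : T -> U) x (O : set U) :
  {within A, continuous f} -> A x -> open O -> O (f x) ->
  exists N, [/\ open N, N x & forall y, N y -> A y -> O (f y)].
Proof.
move=> /subspace_continuousP cf Ax oO Ofx.
have /cf : A x by [].
move=> /(_ O (open_nbhs_nbhs (conj oO Ofx))) h.
have : nbhs x [set y | A y -> O (f y)] by exact: h.
by rewrite nbhsE => -[N [oN Nx] NO]; exists N.
Qed.

Lemma open_within (T U : topologicalType) (A : set T) (f : T -> U) :
  (forall x O, A x -> open O -> O (f x) ->
    exists N, [/\ open N, N x & forall y, N y -> A y -> O (f y)]) ->
  {within A, continuous f}.
Proof.
move=> h; apply/subspace_continuousP => x Ax O nO.
have : nbhs (f x) O by [].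
rewrite nbhsE => -[O' [oO' O'x] OO'].
have [N [oN Nx NO]] := h x O' Ax oO' O'x.
suff : nbhs x [set y | A y -> O (f y)] by [].
by rewrite nbhsE; exists N => // y Ny Ay; exact/OO'/NO.
Qed.

Lemma ropen_pointwise (T : topologicalType) (X A : set T) : A `<=` X ->
  (forall a, A a -> exists O, [/\ open O, O a & forall b, O b -> X b -> A b]) -> ropen X A.
Proof.
move=> AX h; split=> //.
exists (\bigcup_(O in [set O | open O /\ forall b, O b -> X b -> A b]) O); split.
  by apply: bigcup_open => O [].
apply/seteqP; split=> [a Aa|a [[O [_ hO] Oa] Xa]]; last exact: hO.
by split; [have [O [oO Oa hO]] := h a Aa; exists O|exact: AX].
Qed.

Lemma ropen_nbhs (T : topologicalType) (X A : set T) x : ropen X A -> A x ->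
  exists O, [/\ open O, O x & forall b, O b -> X b -> A b].
Proof. by move=> [_ [O [oO ->]]] [Ox _]; exists O; split=> // b. Qed.

(** Tube lemma, obtained as a near covering of [K] along the filter of small neighbourhoods of
    [x]. *)
Lemma compact_tube (T U : topologicalType) (K : set T) (x : U) (P : set U -> T -> Prop) :
  compact K -> (forall A B t, A `<=` B -> P B t -> P A t) ->
  (forall t, K t -> exists O N, [/\ open O, O x, open N, N t & forall t', N t' -> P O t']) ->
  exists O, [/\ open O, O x & forall t, K t -> P O t].
Proof.
move=> /compact_near_coveringP cK aP h.
have := cK _ (powerset_filter_from (nbhs x)) (fun O t => P O t) _.
have pf : Filter (powerset_filter_from (nbhs x)) by exact: powerset_filter_from_filter.
move=> /(_ pf) [].
  move=> t /h[O [N [oO Ox oN Nt PO]]].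
  exists (N, [set A | A `<=` O]) => /=; last by move=> [t' A] [/= /PO] + AO; exact: aP.
  split; first exact: open_nbhs_nbhs.
  apply/near_powerset_filter_fromP; first by move=> A B AB; exact: subset_trans.
  by exists O => //; exact: open_nbhs_nbhs.
move=> E [EN _ [A EA]] hE.
have nA : nbhs x A by exact: EN.
move: nA; rewrite nbhsE => -[O [oO Ox] OA]; exists O; split=> // t Kt.
by apply: aP OA _; exact: hE.
Qed.

Lemma compact_uniform (T : topologicalType) (K : set T) (P : nat -> T -> Prop) :
  compact K -> (forall m n t, m <= n -> P m t -> P n t) ->
  (forall t, K t -> exists n N, [/\ open N, N t & forall t', N t' -> P n t']) ->
  exists n, forall t, K t -> P n t.
Proof.
move=> /compact_near_coveringP cK mP h.
have := cK _ \oo (fun n t => P n t) _.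
move=> [|M _ hM]; last by exists M => t; apply: hM => /=.
move=> t /h[n [N [oN Nt PN]]].
exists (N, [set m | n <= m]) => /=; last by move=> [t' m] [/= /PN] + nm; exact: mP.
by split; [exact: open_nbhs_nbhs|exists n].
Qed.

Lemma rhausdorff_compact_sep (T : topologicalType) (X K : set T) x : rhausdorff X ->
  compact K -> K `<=` X -> X x -> ~ K x -> exists O, [/\ open O, O x & forall y, O y -> ~ K y].
Proof.
move=> hX cK KX Xx nKx.
have [||O [oO Ox hO]] := @compact_tube T T K x (fun O t => ~ O t) cK.
- by move=> A B t AB nB /AB.
- move=> t Kt; have xt : x <> t by move=> E; apply: nKx; rewrite E.
  have [A [B [oA oB Ax Bt AB]]] := hX x t Xx (KX _ Kt) xt.
  exists A, B; split=> // t' Bt' At'.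
  by have : (A `&` B) t' by []; rewrite AB.
- by exists O; split=> // y Oy /hO.
Qed.

(** Second countability gives a countable cover by compact open sets satisfying [Q]; [idx] is the
    least index of a member containing the point. It is locally constant because the members are
    closed as well as open. *)
Lemma lc_cantor_partition (T : topologicalType) (X : set T) (Q : set T -> Prop) :
  lc_cantor X -> (forall A B, A `<=` B -> Q B -> Q A) ->
  (forall x, X x -> exists O, [/\ open O, O x & Q (O `&` X)]) ->
  exists idx : T -> nat,
    (forall x, X x -> exists O, [/\ open O, O x & forall y, O y -> X y -> idx y = idx x]) /\
    (forall n, Q [set x | X x /\ idx x = n]).
Proof.
move=> [[x0 Xx0] [B [cB oB bB]] hX cob _] hQ locQ.
have [f finj] : exists f : set T -> nat, {in B &, injective f} by exact/countable_injP.
pose good K := [/\ compact K, ropen X K & Q K].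
have good0 : good set0.
  split; [exact: compact0 | |].
    by split=> //; exists set0; split; [exact: open0 | rewrite set0I].
  by have [O [_ _ QO]] := locQ _ Xx0; exact: hQ QO.
(* [K m] is a good set around the basic set numbered [m], and empty if no good set contains that
   one. *)
have ex m : exists K, good K /\ forall b, B b -> f b = m ->
    (exists K0, good K0 /\ b `<=` K0) -> b `<=` K.
  have [[b [Bb fb [K0 [gK0 bK0]]]]|no] :=
      pselect (exists b, [/\ B b, f b = m & exists K0, good K0 /\ b `<=` K0]).
    exists K0; split=> // b' Bb' fb' _; have -> // : b' = b.
    by apply: finj; rewrite ?inE // fb fb'.
  exists set0; split=> // b Bb fb hb; exfalso; apply: no; exists b; split=> //.
have [K hK] := choice ex.
have cover x : X x -> exists m, K m x.
  move=> Xx; have [O [oO Ox QO]] := locQ _ Xx.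
  have rO : ropen X (O `&` X) by split; [move=> ? []|exists O].
  have [K0 [rK0 cK0 K0x K0O]] := cob _ x rO (conj Ox Xx).
  have [b [Bb bx bK0]] := bB _ _ rK0 K0x.
  exists (f b); have [_ /(_ b Bb erefl)] := hK (f b); apply=> //.
  by exists K0; split=> //; split=> //; exact: hQ QO.
have cov x : exists n, X x -> K n x /\ forall m, m < n -> ~ K m x.
  have [Xx|nXx] := pselect (X x); last by exists 0.
  have ex' : exists m, `[< K m x >] by have [m /asboolP h] := cover x Xx; exists m.
  have [n /asboolP Kn nmin] := ex_minnP ex'; exists n => _; split=> // m mn Km.
  by have := nmin m (asboolT Km); rewrite leqNgt mn.
have [idx hidx] := choice cov.
exists idx; split=> [x Xx|n]; last first.
  by have [[_ _ QK] _] := hK n; apply: hQ QK => x [Xx <-]; have [] := hidx x Xx.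
have [Kx nKx] := hidx x Xx.
have [O [oO Ox OK]] : exists O, [/\ open O, O x & forall y, O y -> X y -> K (idx x) y].
  by apply: ropen_nbhs Kx; have [[]] := hK (idx x).
(* A neighbourhood of [x] misses the finitely many earlier members, which are compact and do not
   contain [x]. *)
have avoid N : (forall m, m < N -> ~ K m x) ->
    exists O', [/\ open O', O' x & forall y, O' y -> forall m, m < N -> ~ K m y].
  elim: N => [|N IH] hN; first by exists setT; split=> //; exact: openT.
  have [|O1 [oO1 O1x h1]] := IH; first by move=> m mN; apply: hN; exact: ltnW.
  have [[cK [KX _] _] _] := hK N.
  have [O2 [oO2 O2x h2]] := rhausdorff_compact_sep hX cK KX Xx (hN N (ltnSn N)).
  exists (O1 `&` O2); split=> //; first exact: openI.
  by move=> y [/h1 h1y /h2 h2y] m; rewrite ltnS leq_eqVlt => /orP[/eqP->|/h1y].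
have [O' [oO' O'x h']] := avoid _ nKx.
exists (O `&` O'); split=> //; first exact: openI.
move=> y [Oy O'y] Xy; have [Ky nKy] := hidx y Xy.
case: (ltngtP (idx y) (idx x)) => // lt; first by case: (h' _ O'y _ lt).
by case: (nKy _ lt); exact: OK.
Qed.

End TopologyFacts.

(** * The groupoid of the graph with two loops *)

Section BinarySequences.
Local Notation X2 := (bspace E2r E2s).
Local Notation G2 := (GEtype E2r E2s).
Local Open Scope ring_scope.
Implicit Types (a b : nat -> bool).

Definition pt a : X2 := PInf a.

(** The only vertex emits two edges, so it is not singular and no finite path is a boundary path. *)
Lemma bpaths_E2 (x : X2) : bpaths E2r E2s x <-> exists a, x = pt a.
Proof.
split=> [|[a ->] //]; case: x => [v p|a] => [[_ []]|_]; last by exists a.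
- by move=> /(_ true); case: pend.
- by case; apply: sub_finite_set (@finite_finset _ [set: bool]).
Qed.

Lemma shift_pt m a : shift E2r m (pt a) = pt (fun i => a (i + m)%N).
Proof. by []. Qed.

Lemma tail_eq_pt a b (m n : nat) :
  (forall i, a (i + m)%N = b (i + n)%N) -> tail_eq (pt a) m n (pt b).
Proof. by move=> h; split=> //; rewrite !shift_pt; congr PInf; apply/funext. Qed.

Lemma tail_eq_ptE a b (m n : nat) : tail_eq (pt a) m n (pt b) ->
  forall i, a (i + m)%N = b (i + n)%N.
Proof. by move=> [_ _ _ _ [E]] i; have := congr1 (@^~ i) E. Qed.

Lemma same_pt L a : exists N, forall b, (forall i, (i < N)%N -> b i = a i) ->
  same E2r E2s L (pt a) (pt b).
Proof.
exists (\max_(t <- L) size t.2) => b ab t tL.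
have h i : (i < size t.2)%N -> b i = a i.
  by move=> hi; apply: ab; apply: leq_trans hi _; exact: leq_bigmax_seq.
by split=> -[_ s1 s2]; split=> // i hi; rewrite -s2 //= h.
Qed.

Lemma cyl_pt m a b : cyl E2r E2s tt (mkseq a m) (pt b) <-> (forall i, (i < m)%N -> b i = a i).
Proof.
have E i : (i < m)%N -> onth (mkseq a m) i = Some (a i).
  by move=> im; rewrite onth_map onthE (nth_map 0%N) ?size_iota //= nth_iota.
split=> [[_ _ h] i im|h]; first by have := h i; rewrite size_mkseq im E // => /(_ isT) [].
by split=> // i; rewrite size_mkseq => im; rewrite E //= h.
Qed.

(** A prefix exchange between two cylinders. Each shift maps its cylinder bijectively onto the whole
    space, so this is one of the generating sets. *)
Lemma open_bisection_pt a b (m n : nat) :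
  open ([set g | exists a' b', [/\ forall i, (i < m)%N -> a' i = a i,
    forall i, (i < n)%N -> b' i = b i, forall i, a' (i + m)%N = b' (i + n)%N &
    g = (pt a', m%:Z - n%:Z, pt b')]] : set G2).
Proof.
set W := (W in open W).
have cylE k c (x : X2) : cyl E2r E2s tt (mkseq c k) x -> exists2 c', x = pt c' &
    forall i, (i < k)%N -> c' i = c i.
  by move=> cx; have [/bpaths_E2[c' Ec] _ _] := cx; exists c' => //; apply/cyl_pt; rewrite -Ec.
have inj k c (x y : X2) : cyl E2r E2s tt (mkseq c k) x -> cyl E2r E2s tt (mkseq c k) y ->
    shift E2r k x = shift E2r k y -> x = y.
  move=> /cylE[x' -> hx] /cylE[y' -> hy] [E]; congr PInf; apply/funext => i.
  case: (ltnP i k) => ik; first by rewrite hx // hy.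
  by have := congr1 (@^~ (i - k)%N) E; rewrite subnK.
have img k c : shift E2r k @` cyl E2r E2s tt (mkseq c k) = [set x | exists d, x = pt d].
  apply/seteqP; split=> [_ [x /cylE[c' -> _] <-]|_ [d ->]]; first by exists (fun i => c' (i + k)%N).
  exists (pt (capp (mkseq c k) d)).
    by apply/cyl_pt => i ik; rewrite /capp size_mkseq ik nth_mkseq.
  rewrite shift_pt; congr PInf; apply/funext => i.
  by have := capp_shift (mkseq c k) d i; rewrite size_mkseq.
apply: open_GEbase; exists m, n, (cyl E2r E2s tt (mkseq a m)), (cyl E2r E2s tt (mkseq b n)).
split; first by split; [exact: cyl_open|exact: cyl_open|move=> x []|move=> x []].
split; first by split=> x /cylE[c -> _].
split; [exact: inj|exact: inj|by rewrite !img|].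
apply/seteqP; split=> g.
  move=> [a' [b' [ha hb hab ->]]]; exists (pt a'), (pt b'); split=> //; first exact/cyl_pt.
    exact/cyl_pt.
  by have [] := tail_eq_pt hab.
move=> [x [y [/cylE[a' -> ha] /cylE[b' -> hb] E ->]]]; exists a', b'; split=> //.
by apply: tail_eq_ptE; split.
Qed.

End BinarySequences.

(** * Charts of an etale groupoid and the embeddings they define *)

Section Etale.
Context {T : topologicalType} (H : tgroupoid T).
Local Notation C := (gcar H).
Local Notation r := (gr H).
Local Notation s := (gs H).
Hypothesis etH : etale H.

Lemma etale_groupoid : is_groupoid H.
Proof. by case: etH => -[]. Qed.

Lemma unit_r g : C g -> units H (r g).
Proof. by move=> Cg; case: etale_groupoid => /(_ g Cg)[[] ? _ _ []]. Qed.

Lemma unit_s g : C g -> units H (s g).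
Proof. by move=> Cg; case: etale_groupoid => /(_ g Cg)[[] _ ? _ [_ _ ? _]]. Qed.

Lemma unit_rs x : units H x -> r x = x /\ s x = x.
Proof.
move=> [Cx rx]; split=> //; case: etale_groupoid => /(_ x Cx)[_ [_ srx _ _]] _ _ _ _.
by rewrite -{1}rx srx rx.
Qed.

Lemma r_within g O : C g -> open O -> O (r g) ->
  exists N, [/\ open N, N g & forall h, N h -> C h -> O (r h)].
Proof. by case: etH => _ [_ cr _]; exact: within_open. Qed.

Lemma s_within g O : C g -> open O -> O (s g) ->
  exists N, [/\ open N, N g & forall h, N h -> C h -> O (s h)].
Proof.
move=> Cg oO Os; case: etH => -[[cl _ _ _ invE] _ cinv] _.
have rinv h : C h -> r (ginv H h) = s h by move=> /invE[].
have Ci h : C h -> C (ginv H h) by move=> /cl[[]].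
have [|N [oN Ng hN]] := @r_within (ginv H g) O (Ci _ Cg) oO; first by rewrite rinv.
have [N' [oN' N'g hN']] := within_open cinv Cg oN Ng.
exists N'; split=> // h N'h Ch; rewrite -rinv //; apply: hN (Ci _ Ch).
exact: hN'.
Qed.

Lemma r_open g N : C g -> open N -> N g -> exists O, [/\ open O, O (r g) &
  forall x, O x -> units H x -> exists h, [/\ C h, N h & r h = x]].
Proof.
move=> Cg oN Ng; case: etH => _ [_ _ /(_ g Cg)[U [rU Ug _ hU]]].
have rW : ropen C (U `&` N).
  case: rU => UC [U' [oU' EU]]; split; first by move=> h [/UC].
  by exists (U' `&` N); split; [exact: openI|rewrite EU setIAC].
have rI : ropen (units H) (r @` (U `&` N)) by apply: hU => // h [].
have Ir : (r @` (U `&` N)) (r g) by exists g.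
have [O [oO Or hO]] := ropen_nbhs rI Ir.
exists O; split=> // x Ox ux; have [h [Uh Nh] <-] := hO x Ox ux.
by exists h; split=> //; case: rU => /(_ h Uh).
Qed.

(** If g is near a unit, g and r g lie in a set on which [r] is injective; they have the same range,
    so g = r g. *)
Lemma units_ropen : ropen C (units H).
Proof.
apply: ropen_pointwise => [x []//|x ux].
have [Cx rx] := ux; case: etH => _ [_ _ /(_ x Cx)[U [rU Ux Uinj _]]].
have [O [oO Ox hO]] := ropen_nbhs rU Ux.
have [|N [oN Nx hN]] := @r_within x O Cx oO; first by rewrite rx.
exists (O `&` N); split=> //; first exact: openI.
move=> g [Og Ng] Cg; split=> //; apply: Uinj.
- by apply: hO; [exact: hN|case: (unit_r Cg)].
- exact: hO.
- by case: (unit_r Cg).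
Qed.

Local Open Scope ring_scope.

(* The data of a homomorphism to G_{E_2} that is faithful on isotropy and whose
   map [f] on units is continuous and open, but not necessarily injective. *)
Definition chart (f : T -> nat -> bool) (l : T -> int) : Prop :=
  [/\ forall g h, composable H (g, h) -> l (gmul H g h) = l g + l h,
      forall g, C g -> r g = s g -> l g = 0 -> units H g,
      forall g, C g -> exists (m n : nat) (O : set T), [/\ open O, O g &
        forall h, O h -> C h -> l h = m%:Z - n%:Z /\ forall i, f (r h) (i + m)%N = f (s h) (i + n)%N],
      forall x N, units H x -> exists O, [/\ open O, O x &
        forall y, O y -> units H y -> forall i, (i < N)%N -> f y i = f x i] &
      forall x O, units H x -> open O -> O x -> exists N : nat, forall b,
        (forall i, (i < N)%N -> b i = f x i) -> exists y, [/\ O y, units H y & f y = b]].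

Definition chart_map (f : T -> nat -> bool) (l : T -> int) (h : T) : GEtype E2r E2s :=
  (pt (f (r h)), l h, pt (f (s h))).

Lemma chart_car f l g : chart f l -> C g -> GEcar E2r E2s (chart_map f l g).
Proof.
move=> [_ _ /(_ g) c3 _ _] Cg; have [m [n [O [_ Og hO]]]] := c3 Cg.
have [El Ef] := hO g Og Cg; apply/GEcarP; exists m, n; split=> //.
exact: tail_eq_pt.
Qed.

Lemma chart_unit f l x : chart f l -> units H x -> l x = 0.
Proof.
move=> [c1 _ _ _ _] ux; have [Cx _] := ux; have [rx sx] := unit_rs ux.
have cxx : composable H (x, x) by split=> //=; rewrite rx sx.
have := c1 x x cxx; case: etale_groupoid => _ _ _ /(_ x Cx)[+ _] _; rewrite rx => ->.
lia.
Qed.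

Lemma chart_hom f l : chart f l -> ghom H G_E2 (chart_map f l).
Proof.
move=> cfl; split=> [g|g h gh]; first exact: chart_car.
have [/= Cg Ch E] := gh; case: etale_groupoid => _ /(_ g h gh)[_ Er Es] _ _ _.
have [c1 _ _ _ _] := cfl.
by rewrite /= /GE_s /GE_r /= E /chart_map /GE_mul Er Es c1.
Qed.

Lemma chart_continuous f l : chart f l -> {within C, continuous (chart_map f l)}.
Proof.
move=> cfl; apply: open_within => g O Cg oO; have [_ _ c3 c4 _] := cfl.
have [m [n [N [oN Ng hN]]]] := c3 g Cg; have [El Ef] := hN g Ng Cg.
rewrite {1}/chart_map El => Og.
have [L hL] := open_GE oO (tail_eq_pt Ef) Og.
have [M1 hM1] := same_pt L (f (r g)); have [M2 hM2] := same_pt L (f (s g)).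
have [O1 [oO1 O1g h1]] := c4 _ M1 (unit_r Cg).
have [O2 [oO2 O2g h2]] := c4 _ M2 (unit_s Cg).
have [N1 [oN1 N1g k1]] := r_within Cg oO1 O1g.
have [N2 [oN2 N2g k2]] := s_within Cg oO2 O2g.
exists (N `&` (N1 `&` N2)); split=> //; first by apply: openI => //; exact: openI.
move=> h [Nh [N1h N2h]] Ch; have [El' Ef'] := hN h Nh Ch.
rewrite /chart_map El'; apply: hL; first exact: tail_eq_pt.
- by apply: hM1; apply: h1; [exact: k1|exact: unit_r].
- by apply: hM2; apply: h2; [exact: k2|exact: unit_s].
Qed.

(** For an element of a small bisection around the image of g, the first entry is a value [f x].
    Lifting [x] along [r] to some h near g leaves only the second entry to compare. *)
Lemma chart_open f l W : chart f l -> (forall x y, units H x -> units H y -> f x = f y -> x = y) ->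
  ropen C W -> ropen (GEcar E2r E2s) (chart_map f l @` W).
Proof.
move=> cfl finj rW; have [WC _] := rW; apply: ropen_pointwise.
  by move=> _ [g /WC Cg <-]; exact: chart_car.
move=> _ [g Wg <-]; have Cg := WC _ Wg; have [_ _ c3 c4 c5] := cfl.
have [U [oU Ug hU]] := ropen_nbhs rW Wg.
have [m [n [N [oN Ng hN]]]] := c3 g Cg; have [El Ef] := hN g Ng Cg.
have [O1 [oO1 O1g h1]] := c4 _ n (unit_s Cg).
have [N1 [oN1 N1g k1]] := s_within Cg oO1 O1g.
have oUN : open (U `&` (N `&` N1)) by apply: openI => //; exact: openI.
have [Or [oOr Org hr]] := r_open Cg oUN (conj Ug (conj Ng N1g)).
have [M hM] := c5 _ _ (unit_r Cg) oOr Org.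
(* Raising both exponents by [M] keeps the lag and makes first entries of the bisection agree with
   [f (r g)] on [M] bits. *)
have Ef' i : f (r g) (i + (m + M))%N = f (s g) (i + (n + M))%N.
  by rewrite [(m + M)%N]addnC [(n + M)%N]addnC !addnA.
have Ek : (m + M)%N%:Z - (n + M)%N%:Z = m%:Z - n%:Z by lia.
have := open_bisection_pt (f (r g)) (f (s g)) (m + M) (n + M); rewrite Ek.
set W' := (W' in open W') => oW'; exists W'; split=> //.
  by exists (f (r g)), (f (s g)); split=> //; rewrite /chart_map El.
move=> _ [a [b [ha hb hab ->]]] _.
have [|x [Orx ux fx]] := hM a; first by move=> i iM; apply: ha; lia.
have [h [Ch [Uh [Nh N1h]] rh]] := hr x Orx ux.
have [El' Efh] := hN h Nh Ch.
exists h; first exact: hU.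
rewrite /chart_map El' rh fx; congr (_, _, PInf _); apply/funext => i.
(* Below [n] both sequences copy [f (s g)]. From there on [f (s h)] repeats the tail of [a], which
   is matched with [b] by [Ef] before position n + M and by [hab] afterwards. *)
case: (ltnP i n) => hi.
  rewrite (h1 (s h)) //; [|exact: k1|exact: unit_s].
  by rewrite hb // ltn_addr.
rewrite -(subnK hi) -Efh rh fx; set j := (i - n)%N.
case: (ltnP j M) => hj.
  by rewrite ha ?hb -?Ef //; lia.
have e1 : (j - M + (m + M))%N = (j + m)%N by rewrite addnCA subnK // addnC.
have e2 : (j - M + (n + M))%N = (j + n)%N by rewrite addnCA subnK // addnC.
by rewrite -e1 -e2 hab.
Qed.

(** Injectivity: if g and h have the same image, they have equal range and source, and g^-1 h is an
    isotropy element on which [l] vanishes, hence a unit. *)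
Lemma chart_embedding f l : chart f l ->
  (forall x y, units H x -> units H y -> f x = f y -> x = y) ->
  etale_embedding H G_E2 (chart_map f l).
Proof.
move=> cfl finj.
have inj g h : C g -> C h -> chart_map f l g = chart_map f l h -> g = h.
  move=> Cg Ch [Er El Es].
  have {}Er : r g = r h by apply: finj => //; exact: unit_r.
  have {}Es : s g = s h by apply: finj => //; exact: unit_s.
  have [cl mulE assoc unitE invE] := etale_groupoid.
  have [[_ _ Ci] _] := cl _ Cg; have [ri si rE sE] := invE _ Cg.
  have cgi : composable H (ginv H g, h) by split=> //=; rewrite si.
  have cig : composable H (ginv H g, g) by split=> //=; rewrite si.
  have cgig : composable H (g, ginv H g) by split=> //=; rewrite ri.
  have [c1 c2 _ _ _] := cfl.
  have [Cm rm sm] := mulE _ _ cgi.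
  have um : units H (gmul H (ginv H g) h).
    apply: c2 => //; first by rewrite rm sm ri.
    by rewrite c1 // -El -c1 // sE; apply: (chart_unit cfl); exact: unit_s.
  have Em : gmul H (ginv H g) h = s g by have [<- _] := unit_rs um; rewrite rm ri.
  have [_ gs_g] := unitE _ Cg; have [rhh _] := unitE _ Ch.
  by rewrite -gs_g -Em -assoc // rE Er.
split=> //; first exact: chart_hom.
split; [by move=> g; exact: chart_car|exact: chart_continuous|].
move=> g Cg; exists C; split=> //.
  by split=> //; exists setT; split; [exact: openT|rewrite setTI].
by move=> W rW _; exact: chart_open.
Qed.

(** Exchanging prefixes piece by piece changes the lag by the difference of [d] at range and source,
    which vanishes on isotropy. *)
Lemma chart_modify f l (idx : T -> nat) (a c : nat -> seq bool) : chart f l ->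
  (forall x, units H x -> exists O, [/\ open O, O x & forall y, O y -> units H y -> idx y = idx x]) ->
  (forall x, units H x -> starts (a (idx x)) (f x)) ->
  let d i := (size (c i))%:Z - (size (a i))%:Z in
  chart (fun x => capp (c (idx x)) (fun n => f x (n + size (a (idx x)))%N))
        (fun h => l h + d (idx (r h)) - d (idx (s h))).
Proof.
move=> [c1 c2 c3 c4 c5] lidx sa d; split.
- move=> g h gh; have [/= Cg Ch E] := gh; case: etale_groupoid => _ /(_ g h gh)[_ -> ->] _ _ _.
  by rewrite c1 // E; lia.
- by move=> g Cg E; rewrite E addrK => h; exact: c2.
- move=> g Cg; have [m [n [O [oO Og hO]]]] := c3 g Cg.
  have [O1 [oO1 O1g h1]] := lidx _ (unit_r Cg).
  have [O2 [oO2 O2g h2]] := lidx _ (unit_s Cg).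
  have [N1 [oN1 N1g k1]] := r_within Cg oO1 O1g.
  have [N2 [oN2 N2g k2]] := s_within Cg oO2 O2g.
  (* Behind the new prefix, [f] is read after its old prefix; each side is therefore pushed further
     by the old prefix of the other side. *)
  exists (m + size (a (idx (s g))) + size (c (idx (r g))))%N.
  exists (n + size (a (idx (r g))) + size (c (idx (s g))))%N, (O `&` (N1 `&` N2)).
  split=> //; first by apply: openI => //; exact: openI.
  move=> h [Oh [N1h N2h]] Ch; have [El Ef] := hO h Oh Ch.
  have E1 : idx (r h) = idx (r g) by apply: h1; [exact: k1|exact: unit_r].
  have E2 : idx (s h) = idx (s g) by apply: h2; [exact: k2|exact: unit_s].
  rewrite E1 E2; split; first by rewrite El /d; lia.
  move=> i; rewrite !addnA !capp_shift.
  have e1 A B : (i + m + A + B = i + A + B + m)%N by lia.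
  have e2 A B : (i + n + B + A = i + A + B + n)%N by lia.
  by rewrite /= e1 Ef e2.
- move=> x N ux; have [O1 [oO1 O1x h1]] := c4 x (N + size (a (idx x)))%N ux.
  have [O2 [oO2 O2x h2]] := lidx x ux.
  exists (O1 `&` O2); split=> //; first exact: openI.
  move=> y [O1y O2y] uy i iN; rewrite h2 // /capp; case: ltnP => // hi.
  by apply: h1 => //; lia.
- move=> x O ux oO Ox; have [O2 [oO2 O2x h2]] := lidx x ux.
  have [N hN] := c5 x _ ux (openI oO oO2) (conj Ox O2x).
  exists (N + size (c (idx x)))%N => b hb.
  have sb : starts (c (idx x)) b.
    by move=> i hi; rewrite hb ?ltn_addl // (starts_capp _ hi).
  have [|y [[Oy O2y] uy fy]] := hN (capp (a (idx x)) (fun n => b (n + size (c (idx x)))%N)).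
    move=> i iN; rewrite /capp; case: ltnP => hi; first by rewrite (sa x ux _ hi).
    rewrite hb ?capp_shift; last by lia.
    by rewrite subnK.
  exists y; split=> //; rewrite h2 // fy -[RHS](starts_cappE sb); congr capp.
  by apply/funext => n; rewrite capp_shift.
Qed.

Lemma chart_injective f l : lc_cantor (units H) -> chart f l ->
  (forall x, units H x -> exists O, [/\ open O, O x &
    forall y z, O y -> O z -> units H y -> units H z -> f y = f z -> y = z]) ->
  exists f' l', chart f' l' /\ (forall x y, units H x -> units H y -> f' x = f' y -> x = y).
Proof.
move=> cH cfl linj.
have [|| idx [lidx qidx]] := @lc_cantor_partition _ _ (fun A => forall y z, A y -> A z ->
    units H y -> units H z -> f y = f z -> y = z) cH.
- by move=> A B AB h y z Ay Az; apply: h; exact: AB.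
- by move=> x /linj[O [oO Ox hO]]; exists O; split=> // y z [Oy _] [Oz _]; exact: hO.
pose c i := code i false.
exists (fun x => capp (c (idx x)) (fun n => f x (n + size (Nil bool))%N)).
exists (fun h => l h + ((size (c (idx (r h))))%:Z - (size (Nil bool))%:Z)
   - ((size (c (idx (s h))))%:Z - (size (Nil bool))%:Z)).
split; first exact: (@chart_modify f l idx (fun=> [::]) c).
move=> x y ux uy E.
have sx := @starts_capp (c (idx x)) (fun n => f x (n + size (Nil bool))%N).
have sy := @starts_capp (c (idx y)) (fun n => f y (n + size (Nil bool))%N).
rewrite -E in sy.
have Ei : idx x = idx y.
  by case: (ltngtP (idx x) (idx y)) => // h; [have := code_clash sx sy h|have := code_clash sy sx h].
apply: (qidx (idx x) x y) => //; apply/funext => n.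
have := congr1 (@^~ (n + size (c (idx x)))%N) E; by rewrite /= -Ei !capp_shift !addn0.
Qed.

Lemma chart_onto f l : units H !=set0 -> compact (units H) -> chart f l ->
  (forall x y, units H x -> units H y -> f x = f y -> x = y) ->
  exists f' l', [/\ chart f' l',
    forall x y, units H x -> units H y -> f' x = f' y -> x = y &
    forall b, exists2 x, units H x & f' x = b].
Proof.
move=> [x0 ux0] cpt cfl finj; have [c1 c2 c3 c4 c5] := cfl.
(* By compactness one [N] serves all units: a sequence sharing [N] bits with a value of [f] is
   itself a value. *)
have [||N hN] := @compact_uniform _ _ (fun N x => units H x ->
    forall b, (forall i, (i < N)%N -> b i = f x i) -> exists2 y, units H y & f y = b) cpt.
- by move=> m n t mn h ut b hb; apply: h => // i im; apply: hb; exact: leq_trans mn.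
- move=> x ux; have [N hN] := c5 x setT ux openT I.
  have [O [oO Ox hO]] := c4 x N ux.
  exists N, O; split=> // y Oy uy b hb.
  have [|z [_ uz fz]] := hN b; last by exists z.
  by move=> i iN; rewrite hb // hO.
pose w x := mkseq (f x) N.
have wE x b : w x = mkseq b N <-> forall i, (i < N)%N -> b i = f x i.
  split=> [E i iN|h]; first by rewrite -(nth_mkseq false b iN) -E nth_mkseq.
  by apply: (@eq_from_nth _ false); rewrite !size_mkseq // => i iN; rewrite !nth_mkseq // h.
pose S := map (@tval N bool) [seq t <- enum {: N.-tuple bool} | `[< exists2 x, units H x & w x = tval t >]].
have wS x : units H x -> w x \in S.
  move=> ux; have sw : size (w x) == N by rewrite size_mkseq.
  by apply/mapP; exists (Tuple sw) => //; rewrite mem_filter mem_enum andbT; apply/asboolP; exists x.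
have Sw u : u \in S -> exists2 x, units H x & w x = u.
  by move=> /mapP[t]; rewrite mem_filter => /andP[/asboolP[x ux wx] _] ->; exists x.
have uS : uniq S by rewrite (map_inj_uniq (@val_inj _ _ (N.-tuple bool))) filter_uniq ?enum_uniq.
have S0 : (0 < size S)%N by move: (wS _ ux0); case: S {wS Sw uS}.
pose idx x := index (w x) S.
have idxS x : units H x -> (idx x < size S)%N by move=> ux; rewrite index_mem wS.
have nidx x : units H x -> nth [::] S (idx x) = w x by move=> ux; rewrite nth_index // wS.
(* Only the last word lacks its final 1, which makes the code complete; for a single piece it is the
   empty word. *)
pose c i := code i (i == (size S).-1).
pose a := nth [::] S.
have sa x : units H x -> starts (a (idx x)) (f x).
  by move=> ux i; rewrite /a nidx // size_mkseq => iN; rewrite nth_mkseq.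
have lidx x : units H x -> exists O, [/\ open O, O x &
    forall y, O y -> units H y -> idx y = idx x].
  move=> ux; have [O [oO Ox hO]] := c4 x N ux; exists O; split=> // y Oy uy.
  by rewrite /idx; congr index; apply/esym/wE; exact: hO.
have cf' := @chart_modify f l idx a c cfl lidx sa.
exists (fun x => capp (c (idx x)) (fun n => f x (n + size (a (idx x)))%N)).
exists (fun h => l h + ((size (c (idx (r h))))%:Z - (size (a (idx (r h))))%:Z)
   - ((size (c (idx (s h))))%:Z - (size (a (idx (s h))))%:Z)).
split; first exact: cf'.
- move=> x y ux uy E.
  have sx := @starts_capp (c (idx x)) (fun n => f x (n + size (a (idx x)))%N).
  have sy := @starts_capp (c (idx y)) (fun n => f y (n + size (a (idx y)))%N).
  rewrite -E in sy; have ix := idxS x ux; have iy := idxS y uy.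
  have Ei : idx x = idx y.
    case: (ltngtP (idx x) (idx y)) => // h.
      by have /eqP := code_clash sx sy h; lia.
    by have /eqP := code_clash sy sx h; lia.
  apply: finj => //; rewrite -(starts_cappE (sa x ux)) -(starts_cappE (sa y uy)) -Ei; congr capp.
  apply/funext => n; have := congr1 (@^~ (n + size (c (idx x)))%N) E.
  by rewrite /= -Ei !capp_shift.
- move=> b.
  (* The index is the number of leading zeros of [b], capped at the last piece. *)
  have [i iS sb] : exists2 i, (i < size S)%N & starts (c i) b.
    have [ex|h0] := pselect (exists k, b k && (k < (size S).-1)%N); last first.
      exists (size S).-1; first by lia.
      move=> i; rewrite /c eqxx size_code addn0 nth_code /= => iS.
      by apply/negP => bi; apply: h0; exists i; rewrite bi.
    have [k /andP[bk kS] kmin] := ex_minnP ex.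
    exists k; first by lia.
    move=> i; rewrite /c (ltn_eqF kS) size_code addn1 ltnS nth_code /= leq_eqVlt.
    case/orP => [/eqP->|ik]; first by rewrite bk eqxx.
    rewrite (ltn_eqF ik); apply/negP => bi; have := kmin i; rewrite bi (ltn_trans ik kS) => /(_ isT).
    by rewrite leqNgt ik.
  have [x ux wx] := Sw _ (mem_nth [::] iS).
  (* Restoring the old prefix of piece [i] gives a value of [f], by the choice of [N]. *)
  have [|y uy fy] := hN x ux ux (capp (a i) (fun n => b (n + size (c i))%N)).
    move=> j jN; rewrite /capp /a -wx size_mkseq jN nth_mkseq //.
  have wy : w y = a i.
    rewrite /w fy; apply: (@eq_from_nth _ false); rewrite size_mkseq /a -wx ?size_mkseq // => j jN.
    by rewrite !nth_mkseq // /capp size_mkseq jN nth_mkseq.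
  have iy : idx y = i by rewrite /idx wy /a index_uniq.
  exists y => //=; rewrite iy fy -[RHS](starts_cappE sb); congr capp.
  by apply/funext => n; rewrite capp_shift.
Qed.

End Etale.

(* With [a] and [b] the source and target maps of an action and [Uo] the units:
   by properness the nonunit pairs (a p, b p) near (z, z) form a compact set,
   which avoids (z, z) by freeness. *)
Lemma proper_free_separated (TA TZ : topologicalType) (Z : set TZ) (D Uo : set TA) (a b : TA -> TZ) :
  rlocally_compact Z -> rhausdorff Z ->
  (forall p, D p -> Z (a p) /\ Z (b p)) ->
  {within D, continuous a} -> {within D, continuous b} ->
  (forall K : set (TZ * TZ), K `<=` Z `*` Z -> compact K -> compact [set p | D p /\ K (a p, b p)]) ->
  open Uo -> (forall p, D p -> a p = b p -> Uo p) -> (forall p, D p -> Uo p -> a p = b p) ->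
  forall z, Z z -> exists O, [/\ open O, O z & forall p, D p -> O (a p) -> O (b p) -> a p = b p].
Proof.
move=> lcZ hZ abZ ca cb prop oU aU Ua z Zz.
have [U [K [rU Uz UK KZ cK]]] := lcZ z Zz.
have [U' [oU' U'z hU']] := ropen_nbhs rU Uz.
pose C := [set p | D p /\ (K `*` K) (a p, b p)].
have cC : compact C.
  by apply: prop; [move=> [u v] [/= /KZ ? /KZ ?]|exact: compact_setX].
have sep c : {within D, continuous c} -> (forall p, D p -> Z (c p)) -> forall t, D t -> c t <> z ->
    exists O N, [/\ open O, O z, open N, N t & forall t', N t' -> D t' -> ~ O (c t')].
  move=> cc cZ t Dt ct.
  have [V [W [oV oW Vc Wz VW]]] := hZ _ _ (cZ _ Dt) Zz ct.
  have [N [oN Nt hN]] := within_open cc Dt oV Vc.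
  exists W, N; split=> // t' Nt' Dt' Wt'.
  have : (V `&` W) (c t') by split=> //; exact: hN.
  by rewrite VW.
have [||O [oO Oz hO]] := @compact_tube _ _ C z
    (fun O p => D p -> ~ Uo p -> ~ (O (a p) /\ O (b p))) cC.
- by move=> A B p AB h Dp nU [/AB Ba /AB Bb]; exact: h.
- move=> t [Dt _]; have [Ut|nUt] := pselect (Uo t).
    by exists setT, Uo; split=> //; exact: openT.
  have [Ea|na] := pselect (a t = z); last first.
    have [O [N [oO Oz oN Nt h]]] := sep a ca (fun p Dp => (abZ p Dp).1) t Dt na.
    by exists O, N; split=> // t' Nt' Dt' _ [Oa _]; exact: h Oa.
  have nb : b t <> z by move=> Eb; apply: nUt; apply: aU => //; rewrite Ea Eb.
  have [O [N [oO Oz oN Nt h]]] := sep b cb (fun p Dp => (abZ p Dp).2) t Dt nb.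
  by exists O, N; split=> // t' Nt' Dt' _ [_ Ob]; exact: h Ob.
exists (O `&` U'); split=> //; first exact: openI.
move=> p Dp [Oa Ua'] [Ob Ub']; apply: Ua => //; apply: contrapT => nUp.
have [Za Zb] := abZ p Dp.
by apply: (hO p) => //; split=> //; split; apply: UK; apply: hU'.
Qed.

(** * Global sections over a locally compact Cantor space *)

Section GlobalSection.
Context {T TZ : topologicalType} (X : set T) (Z : set TZ) (rho : TZ -> T).
Hypothesis cX : lc_cantor X.
Hypothesis rhoX : forall z, Z z -> X (rho z).
Hypothesis rhoC : {within Z, continuous rho}.
Hypothesis rhoO : forall W, ropen Z W -> ropen X (rho @` W).
Hypothesis rhoS : rho @` Z = X.
Hypothesis rhoI : forall z, Z z -> exists O, [/\ open O, O z &
  forall z1 z2, Z z1 -> Z z2 -> O z1 -> O z2 -> rho z1 = rho z2 -> z1 = z2].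

(** Local sections are glued along a partition into pieces, each covered by an open set on which
    [rho] is injective. The last clause says that the image of [sec] is open and that [sec] inverts
    [rho] there. *)
Lemma global_section : exists sec : T -> TZ,
  [/\ forall x, X x -> Z (sec x) /\ rho (sec x) = x,
      forall x O, X x -> open O -> O (sec x) ->
        exists N, [/\ open N, N x & forall y, N y -> X y -> O (sec y)] &
      forall x N, X x -> open N -> N x -> exists O, [/\ open O, O (sec x) &
        forall z, O z -> Z z -> sec (rho z) = z /\ N (rho z)]].
Proof.
have [||idx [lidx qidx]] := @lc_cantor_partition _ X (fun A => exists U, [/\ ropen Z U,
    (forall z1 z2, U z1 -> U z2 -> rho z1 = rho z2 -> z1 = z2) & A `<=` rho @` U]) cX.
- by move=> A B AB [U [rU iU BU]]; exists U; split=> //; exact: subset_trans BU.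
- move=> x Xx; have : (rho @` Z) x by rewrite rhoS.
  move=> [z Zz rz]; have [O [oO Oz iO]] := rhoI Zz.
  have rU : ropen Z (O `&` Z) by split; [move=> ? []|exists O].
  have Ix : (rho @` (O `&` Z)) x by exists z.
  have [N [oN Nx hN]] := ropen_nbhs (rhoO rU) Ix.
  exists N; split=> //; exists (O `&` Z); split=> //; last by move=> y [Ny Xy]; exact: hN.
  by move=> z1 z2 [? ?] [? ?]; exact: iO.
have [U hU] := choice qidx.
have [x0 Xx0] : X !=set0 by case: cX.
have ex x : exists z, X x -> U (idx x) z /\ rho z = x.
  have [Xx|nXx] := pselect (X x).
    have [_ _ /(_ x)[|z Uz rz]] := hU (idx x); first by split.
    by exists z.
  have : (rho @` Z) x0 by rewrite rhoS.
  by move=> [z _ _]; exists z.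
have [sec hsec] := choice ex.
have UZ n z : U n z -> Z z by move=> Uz; have [[h _] _ _] := hU n; exact: h.
have Ui n z1 z2 : U n z1 -> U n z2 -> rho z1 = rho z2 -> z1 = z2 by have [_ h _] := hU n; exact: h.
exists sec; split=> [x Xx|x O Xx oO Os|x N Xx oN Nx].
- by have [Us rs] := hsec x Xx; split=> //; exact: UZ Us.
- have [Us rs] := hsec x Xx; have [N1 [oN1 N1x h1]] := lidx x Xx.
  have rUO : ropen Z (U (idx x) `&` O).
    have [[UZ' [V [oV EV]]] _ _] := hU (idx x); split; first by move=> z [/UZ'].
    by exists (V `&` O); split; [exact: openI|rewrite EV setIAC].
  have Ix : (rho @` (U (idx x) `&` O)) x by exists (sec x).
  have [N2 [oN2 N2x h2]] := ropen_nbhs (rhoO rUO) Ix.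
  exists (N1 `&` N2); split=> //; first exact: openI.
  move=> y [N1y N2y] Xy; have [z [Uz Oz] rz] := h2 y N2y Xy.
  have [Usy rsy] := hsec y Xy; rewrite h1 // in Usy.
  by rewrite (Ui _ _ _ Usy Uz) // rsy rz.
- have [Us rs] := hsec x Xx; have [N1 [oN1 N1x h1]] := lidx x Xx.
  have [rU _ _] := hU (idx x); have [O1 [oO1 O1s k1]] := ropen_nbhs rU Us.
  have [|O2 [oO2 O2s k2]] := within_open rhoC (UZ _ _ Us) (openI oN oN1).
    by rewrite rs.
  exists (O1 `&` O2); split=> //; first exact: openI.
  move=> z [O1z O2z] Zz; have [Nr N1r] := k2 z O2z Zz; split=> //.
  have [Usr rsr] := hsec (rho z) (rhoX Zz); rewrite h1 // in Usr; last exact: rhoX.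
  by apply: (Ui (idx x)) => //; exact: k1.
Qed.

End GlobalSection.

(** * From a groupoid equivalence to a chart *)

Section Linking.
Context {T : topologicalType} (H : tgroupoid T).
Context {V Ed : countType} (er es : Ed -> V).
Context {TZ : topologicalType} (Z : set TZ) (rho : TZ -> T) (sig : TZ -> GEtype er es).
Context (la : T -> TZ -> TZ) (ra : TZ -> GEtype er es -> TZ).
Local Notation G := (graph_groupoid er es).
Local Notation bpath := (bpaths er es).
Local Notation C := (gcar H).
Local Notation r := (gr H).
Local Notation s := (gs H).
Local Notation LD := [set p : T * TZ | [/\ gcar H p.1, Z p.2 & gs H p.1 = rho p.2]].
Local Notation RD := [set p : TZ * GEtype er es | [/\ Z p.1, gcar G p.2 & sig p.1 = gr G p.2]].
Local Open Scope ring_scope.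

Hypothesis etH : etale H.
Hypothesis cH : lc_cantor (units H).
Hypotheses (cL : condL er es) (nosink : no_sinks es) (nst : no_semi_tails er es).
Hypotheses (lcZ : rlocally_compact Z) (hZ : rhausdorff Z).
Hypotheses (rhoU : forall z, Z z -> units H (rho z)) (rhoC : {within Z, continuous rho}).
Hypotheses (sigU : forall z, Z z -> units G (sig z)) (sigC : {within Z, continuous sig}).
Hypothesis laZ : forall p, LD p -> Z (la p.1 p.2) /\ rho (la p.1 p.2) = r p.1.
Hypothesis laM : forall g g' z, composable H (g, g') -> LD (g', z) ->
  la (gmul H g g') z = la g (la g' z).
Hypothesis la1 : forall z, Z z -> la (rho z) z = z.
Hypothesis laC : {within LD, continuous (fun p : T * TZ => la p.1 p.2)}.
Hypothesis laF : forall p, LD p -> la p.1 p.2 = p.2 -> p.1 = rho p.2.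
Hypothesis laP : forall K : set (TZ * TZ), K `<=` Z `*` Z -> compact K ->
  compact [set p | LD p /\ K (la p.1 p.2, p.2)].
Hypothesis raZ : forall p, RD p -> Z (ra p.1 p.2) /\ sig (ra p.1 p.2) = gs G p.2.
Hypothesis raM : forall z h h', composable G (h, h') -> RD (z, h) ->
  ra z (gmul G h h') = ra (ra z h) h'.
Hypothesis ra1 : forall z, Z z -> ra z (sig z) = z.
Hypothesis raC : {within RD, continuous (fun p : TZ * GEtype er es => ra p.1 p.2)}.
Hypothesis raF : forall p, RD p -> ra p.1 p.2 = p.1 -> p.2 = sig p.1.
Hypothesis raP : forall K : set (TZ * TZ), K `<=` Z `*` Z -> compact K ->
  compact [set p | RD p /\ K (p.1, ra p.1 p.2)].
Hypothesis comm : forall g z h, LD (g, z) -> RD (z, h) ->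
  [/\ rho (ra z h) = rho z, sig (la g z) = sig z & la g (ra z h) = ra (la g z) h].
Hypothesis rhoO : forall W, ropen Z W -> ropen (units H) (rho @` W).
Hypothesis rhoS : rho @` Z = units H.
Hypothesis rhoE : forall z1 z2, Z z1 -> Z z2 -> rho z1 = rho z2 -> exists h, RD (z2, h) /\ z1 = ra z2 h.
Hypothesis sigO : forall W, ropen Z W -> ropen (units G) (sig @` W).
Hypothesis sigE : forall z1 z2, Z z1 -> Z z2 -> sig z1 = sig z2 -> exists g, LD (g, z2) /\ z1 = la g z2.

(* The boundary path [x] for which [sig z] is the unit (x, 0, x). *)
Let bp z : bspace er es := (sig z).1.1.

Lemma sig_bp z : Z z -> bpath (bp z) /\ sig z = (bp z, 0, bp z).
Proof. by move=> /sigU/unitsE. Qed.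

Lemma RD_sig z : Z z -> RD (z, sig z).
Proof.
move=> Zz; have [cz _] := sigU Zz; split=> //=.
by have [_ ->] := sig_bp Zz.
Qed.

Lemma RD_intro z g : Z z -> GEcar er es g -> g.1.1 = bp z -> RD (z, g).
Proof. by move=> Zz cg E; split=> //=; rewrite /GE_r E; have [_] := sig_bp Zz. Qed.

Lemma RD_elim z g : RD (z, g) -> [/\ Z z, GEcar er es g & g.1.1 = bp z].
Proof. by move=> [Zz cg /= E]; split=> //; rewrite /bp E. Qed.

Lemma LD_unit z : Z z -> LD (rho z, z).
Proof.
by move=> Zz; have [rz sz] := unit_rs etH (rhoU Zz); have [cz _] := rhoU Zz.
Qed.

(** The fibres of [rho] are orbits of the right action, and a free proper action with open unit
    space keeps distinct points of an orbit apart locally. *)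
Lemma rho_injective z : Z z -> exists O, [/\ open O, O z &
  forall z1 z2, Z z1 -> Z z2 -> O z1 -> O z2 -> rho z1 = rho z2 -> z1 = z2].
Proof.
move=> Zz.
have oU : open [set p : TZ * GEtype er es | units G p.2].
  apply: (@open_comp _ _ snd); first by move=> p _; exact: cvg_snd.
  exact: open_units_GE.
have cb : {within RD, continuous (fun p : TZ * GEtype er es => p.1)}.
  by apply: continuous_subspaceT => p; exact: cvg_fst.
have hZZ p : RD p -> Z p.1 /\ Z (ra p.1 p.2) by move=> Dp; have [] := raZ Dp; case: Dp.
have UU p : RD p -> p.1 = ra p.1 p.2 -> units G p.2.
  move=> Dp /esym/(raF Dp) ->; apply: sigU; by case: Dp.
have UU' p : RD p -> units G p.2 -> p.1 = ra p.1 p.2.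
  move=> [Zp cp E] [_ up]; have -> : p.2 = sig p.1 by rewrite E up.
  by rewrite ra1.
have [O [oO Oz hO]] := proper_free_separated lcZ hZ hZZ cb raC raP oU UU UU' Zz.
exists O; split=> // z1 z2 Z1 Z2 O1 O2 E.
have [h [Dh E1]] := rhoE Z1 Z2 E.
by have /= := hO (z2, h) Dh O2; rewrite -E1 => /(_ O1).
Qed.

Lemma sig_injective z : Z z -> exists O, [/\ open O, O z &
  forall z1 z2, Z z1 -> Z z2 -> O z1 -> O z2 -> sig z1 = sig z2 -> z1 = z2].
Proof.
(* The units of [H] are open only inside its carrier, so an ambient open set [U] cutting them out
   takes their place. *)
move=> Zz; have [_ [U [oU EU]]] := units_ropen etH.
have oU' : open [set p : T * TZ | U p.1].
  by apply: (@open_comp _ _ fst) => // p _; exact: cvg_fst.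
have cb : {within LD, continuous (fun p : T * TZ => p.2)}.
  by apply: continuous_subspaceT => p; exact: cvg_snd.
have hZZ p : LD p -> Z (la p.1 p.2) /\ Z p.2 by move=> Dp; have [] := laZ Dp; case: Dp.
have UU p : LD p -> la p.1 p.2 = p.2 -> U p.1.
  move=> Dp /(laF Dp) ->; have : units H (rho p.2) by apply: rhoU; case: Dp.
  by rewrite EU => -[].
have UU' p : LD p -> U p.1 -> la p.1 p.2 = p.2.
  move=> [cp Zp E] Up; have up : units H p.1 by rewrite EU.
  by have [_ sp] := unit_rs etH up; rewrite -[X in la X _]sp E la1.
have [O [oO Oz hO]] := proper_free_separated lcZ hZ hZZ laC cb laP oU' UU UU' Zz.
exists O; split=> // z1 z2 Z1 Z2 O1 O2 E.
have [g [Dg E1]] := sigE Z1 Z2 E.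
by have /= := hO (g, z2) Dg; rewrite -E1 => /(_ O1 O2).
Qed.

(** [g] and [g'] have the same source, and g g'^-1 fixes [z]; freeness makes it a unit. *)
Lemma ra_inj z g g' : RD (z, g) -> RD (z, g') -> ra z g = ra z g' -> g = g'.
Proof.
move=> Dg Dg' E; have [Zz cg g1] := RD_elim Dg; have [_ cg' g1'] := RD_elim Dg'.
have g2 : g.2 = g'.2.
  have [_] := raZ Dg; have [_] := raZ Dg'; rewrite /= E => -> [].
  by rewrite /GE_s => <-.
have ci := GEcar_inv cg'.
have c1 : composable G (g, GE_inv g') by split=> //=; rewrite /GE_s /GE_r /= g2.
have c2 : composable G (g', GE_inv g') by split.
have cm : GEcar er es (GE_mul g (GE_inv g')) by exact: GEcar_mul.
have Em : ra z (GE_mul g (GE_inv g')) = z.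
  rewrite (raM c1 Dg) E -(raM c2 Dg') /= /GE_mul /= addrN g1'.
  by have [_ <-] := sig_bp Zz; exact: ra1.
have Dm : RD (z, GE_mul g (GE_inv g')) by apply: RD_intro.
have /= := raF Dm Em; have [_ ->] := sig_bp Zz => -[_ /eqP].
rewrite subr_eq0 => /eqP Ek _.
by case: g g' g1 g1' g2 Ek {Dg Dg' E cg cg' ci c1 c2 cm Em Dm} => [[x k] y] [[x' k'] y'] /= -> -> -> ->.
Qed.

(** [f] codes the boundary path [bp (sec x)], and [l] is the lag of the element [ga h] carrying
    [sec (r h)] to [la h (sec (s h))]. *)
Lemma equivalence_chart : exists f l, chart H f l /\
  (forall x, units H x -> exists O, [/\ open O, O x &
    forall y z, O y -> O z -> units H y -> units H z -> f y = f z -> y = z]).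
Proof.
have [sec [S1 S2 S3]] := global_section cH rhoU rhoC rhoO rhoS rho_injective.
have Zs x : units H x -> Z (sec x) by move=> /S1[].
have rs x : units H x -> rho (sec x) = x by move=> /S1[].
have LDs h : C h -> LD (h, sec (s h)).
  by move=> Ch; have us := unit_s etH Ch; split=> //=; [exact: Zs|rewrite rs].
have [x0 ux0] : units H !=set0 by case: cH.
have exg h : exists g, C h -> RD (sec (r h), g) /\ la h (sec (s h)) = ra (sec (r h)) g.
  have [Ch|nCh] := pselect (C h); last by exists (sig (sec x0)).
  have ur := unit_r etH Ch; have [Zl El] := laZ (LDs h Ch).
  by have [|g hg] := rhoE Zl (Zs _ ur); [rewrite El rs|exists g].
have [ga hga] := choice exg.
pose bx x := bp (sec x).
have bbx x : units H x -> bpath (bx x) by move=> /Zs/sig_bp[].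
have ga_car h : C h -> GEcar er es (ga h) by move=> /hga[/RD_elim[]].
have ga_r h : C h -> (ga h).1.1 = bx (r h) by move=> /hga[/RD_elim[]].
have ga_s h : C h -> (ga h).2 = bx (s h).
  move=> Ch; have [D E] := hga h Ch; have [_ Es] := raZ D.
  have [_ Es' _] := comm (LDs h Ch) (RD_sig (Zs _ (unit_s etH Ch))).
  by rewrite /bx /bp -Es' E Es.
(* By freeness the defining equation determines [ga h], so identities for [ga] follow by checking
   that equation. *)
have ga_eq h g : C h -> RD (sec (r h), g) -> la h (sec (s h)) = ra (sec (r h)) g -> ga h = g.
  by move=> Ch Dg E; have [D E'] := hga h Ch; apply: ra_inj D Dg _; rewrite -E' E.
have ga_mul g h : composable H (g, h) -> ga (gmul H g h) = GE_mul (ga g) (ga h).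
  move=> gh; have [/= Cg Ch Egh] := gh.
  have [_ mulE _ _ _] := etale_groupoid etH; have [Cm Er Es] := mulE g h gh.
  have Ec : (ga g).2 = (ga h).1.1 by rewrite ga_s // ga_r // Egh.
  apply: ga_eq => //; rewrite Er ?Es.
    apply: RD_intro; [exact/Zs/unit_r|exact: GEcar_mul (ga_car _ Cg) (ga_car _ Ch) Ec|exact: ga_r].
  have cc : composable G (ga g, ga h).
    by split; [exact: ga_car|exact: ga_car|rewrite /= /GE_s /GE_r Ec].
  have [Dg Eg] := hga g Cg; have [Dh Eh] := hga h Ch.
  rewrite (raM cc Dg) -Eg (laM gh (LDs h Ch)) Eh Egh.
  rewrite -Egh in Dh *.
  by have [_ _ ->] := comm (LDs g Cg) Dh.
have bx_cont x L : units H x -> exists N, [/\ open N, N x &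
    forall y, N y -> units H y -> same er es L (bx x) (bx y)].
  move=> ux; have Zx := Zs x ux; have [bX sX] := sig_bp Zx.
  have := @open_diag _ _ er es _ (same_open L (bx x)) (fun y => @proj1 _ _).
  set W := (W in open W) => oW; have Wx : W (sig (sec x)) by exists (bx x).
  have [N1 [oN1 N1x h1]] := within_open sigC Zx oW Wx.
  have [N [oN Nx hN]] := S2 x N1 ux oN1 N1x; exists N; split=> // y Ny uy.
  by have [y' [_ Sy] Ey] := h1 _ (hN y Ny uy) (Zs y uy); rewrite {2}/bx /bp Ey.
(* Near [h0], the element of the bisection through [ga h0] with the right range
   moves [sec (r h)] close to [la h (sec (s h))], in the same fibre of [rho];
   the two agree by local injectivity of [rho]. *)
have ga_local h0 (m n : nat) : C h0 -> tail_eq (bx (r h0)) m n (bx (s h0)) ->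
    (ga h0).1.2 = m%:Z - n%:Z -> exists O, [/\ open O, O h0 & forall h, O h -> C h ->
    [/\ tail_eq (bx (r h)) m n (bx (s h)), (ga h).1.2 = m%:Z - n%:Z,
        pfx (bx (r h)) m = pfx (bx (r h0)) m & pfx (bx (s h)) n = pfx (bx (s h0)) n]].
  move=> C0 t0 k0; have [D0 E0] := hga h0 C0.
  have ga0 : ga h0 = (bx (r h0), m%:Z - n%:Z, bx (s h0)).
    by rewrite -k0 -ga_r // -ga_s //; case: (ga h0) => -[].
  have [Zl El] := laZ (LDs h0 C0).
  have [O1 [oO1 O1z inj1]] := rho_injective Zl.
  have [N1 [oN1 N1z h1]] := within_open laC (LDs h0 C0) oO1 O1z.
  have O1z' : O1 (ra (sec (r h0)) (ga h0)) by rewrite -E0.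
  have [N2 [oN2 N2z h2]] := within_open raC D0 oO1 O1z'.
  have := open_nbhs_nbhs (conj oN1 N1z) => -[[A1 B1] [/= nA1 nB1] AB1].
  have := open_nbhs_nbhs (conj oN2 N2z) => -[[A2 B2] [/= nA2 nB2] AB2].
  move: nA1; rewrite nbhsE => -[A1' [oA1 A1x] A1A].
  move: nB1; rewrite nbhsE => -[B1' [oB1 B1x] B1B].
  move: nA2; rewrite nbhsE => -[A2' [oA2 A2x] A2A].
  move: nB2; rewrite nbhsE => -[B2' [oB2 B2x] B2B].
  rewrite ga0 in B2x; have [L hL] := local_bisection oB2 t0 B2x.
  have ur := unit_r etH C0; have us := unit_s etH C0.
  have [M1 [oM1 M1x k1]] := bx_cont (r h0) L ur.
  have [M2 [oM2 M2x k2]] := S2 _ _ ur oA2 A2x.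
  have [M3 [oM3 M3x k3]] := S2 _ _ us oB1 B1x.
  have [P1 [oP1 P1x q1]] := r_within etH C0 (openI oM1 oM2) (conj M1x M2x).
  have [P2 [oP2 P2x q2]] := s_within etH C0 oM3 M3x.
  exists (A1' `&` (P1 `&` P2)); split=> //; first by apply: openI => //; exact: openI.
  move=> h [A1h [P1h P2h]] Ch; have [M1h M2h] := q1 h P1h Ch; have M3h := q2 h P2h Ch.
  have urh := unit_r etH Ch; have ush := unit_s etH Ch.
  have [y' [t' px py B2y]] := hL _ (bbx _ urh) (k1 _ M1h urh).
  pose g := (bx (r h), m%:Z - n%:Z, y') : GEtype er es.
  have cg : GEcar er es g by apply/GEcarP; exists m, n.
  have Dg : RD (sec (r h), g) by apply: RD_intro => //; exact: Zs.
  have O1g : O1 (ra (sec (r h)) g).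
    apply: (h2 (sec (r h), g)) => //; apply: AB2; split; first exact/A2A/k2.
    exact: B2B.
  have O1h : O1 (la h (sec (s h))).
    apply: (h1 (h, sec (s h))); last exact: LDs.
    apply: AB1; split; first exact: A1A.
    exact/B1B/k3.
  have [Zg _] := raZ Dg; have [Zh rh] := laZ (LDs h Ch).
  have [rg _ _] := comm (LD_unit (Zs _ urh)) Dg.
  have Egh : ga h = g.
    apply: ga_eq => //; apply: inj1 => //; rewrite rh /= rg rs //.
  have Ey : y' = bx (s h) by rewrite -ga_s // Egh.
  by rewrite Egh -Ey.
pose f x := coding es (bx x); pose l h := lag (ga h).
have lE h (m n : nat) : C h -> tail_eq (bx (r h)) m n (bx (s h)) -> (ga h).1.2 = m%:Z - n%:Z ->
    l h = (size (word es (bx (r h)) m))%:Z - (size (word es (bx (s h)) n))%:Z.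
  move=> Ch t k; rewrite /l; have -> : ga h = (bx (r h), m%:Z - n%:Z, bx (s h)).
    by rewrite -k -ga_r // -ga_s //; case: (ga h) => -[].
  exact: lagE.
exists f, l; split; first split.
- move=> g h gh; have [/= Cg Ch E] := gh; rewrite /l ga_mul // lagM //; try exact: ga_car.
  by rewrite ga_s // ga_r // E.
(* An isotropy element with lag 0 has a unit as [ga h], so it fixes [sec (s h)], and the left action
   is free. *)
- move=> h Ch Ers l0; have ur := unit_r etH Ch.
  have Eg : ga h = (bx (r h), (ga h).1.2, bx (r h)).
    by have := ga_s h Ch; have := ga_r h Ch; rewrite -Ers; case: (ga h) => -[x k] y /= -> ->.
  have cg := ga_car h Ch; rewrite /l Eg in l0; rewrite Eg in cg.
  have k0 := lag_isotropy cL cg l0; rewrite k0 in Eg.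
  have [D E] := hga h Ch; have [_ sE'] := sig_bp (Zs _ ur).
  rewrite Eg -[(_, _, _)]sE' ra1 -?Ers in E; last exact: Zs.
  have := laF (LDs h Ch); rewrite /= -Ers => /(_ E).
  by rewrite rs // => ->.
- move=> h0 C0; have /GEcarP[m [n [t0 k0]]] := ga_car h0 C0.
  rewrite ga_r // ga_s // in t0.
  have [O [oO Oh hO]] := ga_local h0 m n C0 t0 k0.
  exists (size (word es (bx (r h0)) m)), (size (word es (bx (s h0)) n)), O; split=> // h Oh' Ch.
  have [t k px py] := hO h Oh' Ch.
  have wx : word es (bx (r h)) m = word es (bx (r h0)) m by rewrite /word px.
  have wy : word es (bx (s h)) n = word es (bx (s h0)) n by rewrite /word py.
  split; first by rewrite (lE h m n) // wx wy.
  move=> i; rewrite -wx -wy /f !(coding_shift er); congr coding.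
  by case: t.
- move=> x N ux; have [L hL] := coding_cont cL nst N (bbx x ux).
  have [O [oO Ox hO]] := bx_cont x L ux; exists O; split=> // y Oy uy.
  by apply: hL; [exact: bbx|exact: hO].
(* A sequence near [f x] codes a path near [bx x]; that path lifts along the open map [sig] to a
   point near [sec x], where [sec] inverts [rho]. *)
- move=> x O ux oO Ox; have Zx := Zs x ux; have [bX sX] := sig_bp Zx.
  have [O1 [oO1 O1x h1]] := S3 x O ux oO Ox.
  have rW : ropen Z (O1 `&` Z) by split; [move=> ? []|exists O1].
  have Ix : (sig @` (O1 `&` Z)) (sig (sec x)) by exists (sec x).
  have [U [oU Ux hU]] := ropen_nbhs (sigO rW) Ix.
  have t0 := tail_eq0 bX.
  have [|L hL] := open_GE oU t0; first by rewrite subrr -sX.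
  have [N hN] := coding_open cL nosink nst L bX; exists N => b hb.
  have [y [bY _ fy sy]] := hN b hb.
  have uy : units G (y, 0, y) by apply/unitsE.
  have ty := tail_eq0 bY.
  have Uy : U (y, 0, y) by have := hL y y ty sy sy; rewrite subrr.
  have [z [O1z Zz] Ez] := hU _ Uy uy.
  have [Esz Oz] := h1 z O1z Zz.
  exists (rho z); split; [exact: Oz|exact: rhoU|].
  by rewrite /f /bx Esz /bp Ez.
- move=> x ux; have Zx := Zs x ux.
  have [O1 [oO1 O1x i1]] := sig_injective Zx.
  have [N1 [oN1 N1x h1]] := S2 x O1 ux oO1 O1x.
  (* The test with the empty word fixes the source vertex, as [coding_inj] compares paths with a
     common source. *)
  have [N2 [oN2 N2x h2]] := bx_cont x [:: (psrc es (bx x), [::])] ux.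
  exists (N1 `&` N2); split=> //; first exact: openI.
  move=> y z [N1y N2y] [N1z N2z] uy uz E.
  have src u : N2 u -> units H u -> psrc es (bx u) = psrc es (bx x).
    move=> N2u uu; have /(_ _ (mem_head _ _)) [/= h _] := h2 u N2u uu.
    by have [|_ -> _] := h; first by split=> //; exact: bbx.
  have Eb : bx y = bx z.
    by apply: (@coding_inj _ _ er es) => //; [exact: bbx|exact: bbx|rewrite !src].
  have Es : sec y = sec z.
    apply: i1; [exact: Zs|exact: Zs|exact: h1|exact: h1|].
    by have [_ ->] := sig_bp (Zs y uy); have [_ ->] := sig_bp (Zs z uz); rewrite -/(bx y) -/(bx z) Eb.
  by rewrite -(rs y uy) -(rs z uz) Es.
Qed.

End Linking.

(** * The embedding, and surjectivity on compact unit spaces *)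

Theorem theorem11p16 (T : topologicalType) (H : tgroupoid T) :
  effective H -> ample H ->
  rsecond_countable (gcar H) -> rhausdorff (gcar H) ->
  lc_cantor (units H) ->
  (exists (V Ed : countType) (er es : Ed -> V),
      [/\ condL er es, no_sinks es, no_semi_tails er es &
          groupoid_equivalent H (graph_groupoid er es)]) ->
  (exists phi : T -> GEtype E2r E2s, etale_embedding H G_E2 phi) /\
  (compact (units H) ->
     exists phi : T -> GEtype E2r E2s,
       etale_embedding H G_E2 phi /\ phi @` units H = units G_E2).
Proof.
move=> _ [etH _ _] _ _ cH [V [Ed [er [es [cL ns nst]]]]].
move=> [TZ [Z [rho [sig [la [ra [[lcZ hZ] [[rhoU rhoC sigU sigC]]]]]]]]].
move=> [[laZ laM la1 laC] [laF laP]] [[raZ raM ra1 raC] [raF raP]] comm.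
move=> [[rhoO rhoS rhoE] [sigO _ sigE]].
have [f0 [l0 [c0 i0]]] := equivalence_chart etH cH cL ns nst lcZ hZ rhoU rhoC sigU sigC laZ laM la1
  laC laF laP raZ raM ra1 raC raF raP comm rhoO rhoS rhoE sigO sigE.
have [f [l [cfl finj]]] := chart_injective etH cH c0 i0.
split; first by exists (chart_map H f l); exact: chart_embedding.
move=> cpt; have ne : units H !=set0 by case: cH.
have [f' [l' [cfl' finj' fonto]]] := chart_onto etH ne cpt cfl finj.
exists (chart_map H f' l'); split; first exact: chart_embedding.
apply/seteqP; split=> g.
  move=> [x ux <-]; have [rx sx] := unit_rs etH ux; apply/unitsE.
  by rewrite /chart_map rx sx (chart_unit etH cfl' ux).
move=> /unitsE[/bpaths_E2[b Eb] ->]; have [x ux fx] := fonto b.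
exists x => //; have [rx sx] := unit_rs etH ux.
by rewrite /chart_map rx sx (chart_unit etH cfl' ux) fx Eb.
Qed.
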